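(* Let $n,\lambda,\mu,b\in\mathbb C$, $\mu\neq0$, $b\notin\mathbb Z$, $b+n\notin\mathbb Z$. The equation $$z^2E''+(nz+\mu(1-z^2))E'+(\lambda-\mu nz)E=0$$ has a monodromy eigenfunction with eigenvalue $e^{2\pi i b}$ if and only if $$(b+1)(b+n-2)R_{1,11}T_{0,11}+\mu^2R_{1,21}T_{0,21}=0 .$$
   Context: The monodromy operator of the equation acts on germs of its solutions at a nonzero point by analytic continuation along a counterclockwise circuit around zero. A monodromy eigenfunction with eigenvalue $e^{2\pi ib}$ is a not identically zero solution of the form $E(z)=z^bf(z)$ with $f$ holomorphic on $\mathbb C^*=\mathbb C\setminus\{0\}$. The matrices are $$M_k=\begin{pmatrix}1+\frac{\lambda}{(k+b)(k+b+n-1)} & \frac{\mu^2}{(k+b)(k+b+n-1)}\\ 1&0\end{pmatrix},\qquad R_k=M_kM_{k+1}\cdots,$$ $$S_m=\begin{pmatrix}1+\frac{\lambda-n+2}{(b-m+1)(b-m+n-2)} & \frac{\mu^2(b-m+n-1)}{(b-m+1)(b-m+n-2)(b-m+n-3)}\\ 1&0\end{pmatrix},\qquad T_m=S_mS_{m+1}\cdots$$ (the infinite products converge), and $R_{k,ij}$, $T_{m,ij}$ denote the matrix elements of $R_k$, $T_m$. *)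

(* Defs.v *)
From HB Require Import structures.
From mathcomp Require Import all_boot all_order all_algebra.
From mathcomp Require Import all_classical all_reals all_analysis.
From mathcomp Require Import complex.
Set Implicit Arguments.
Unset Strict Implicit.
Unset Printing Implicit Defensive.
Import Order.TTheory GRing.Theory Num.Theory.
Import numFieldNormedType.Exports.
Local Open Scope ring_scope.
Local Open Scope complex_scope.
Local Open Scope classical_set_scope.

(* MathComp-Analysis puts a topology on (the sort of) any numClosedFieldType,
   but not directly on the type R[i]; hence this packed name. With C as scalar
   field, [derivable f z 1] and [derive1] are complex differentiability and the
   complex derivative. *)
Definition Cplx (R : realType) : numClosedFieldType := R[i].

Definition cexp (R : realType) (z : Cplx R) : Cplx R :=
  (expR (complex.Re z) * cos (complex.Im z))
    +i* (expR (complex.Re z) * sin (complex.Im z)).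

Definition holomorphic_on (R : realType) (U : set (Cplx R))
    (f : Cplx R -> Cplx R) : Prop :=
  forall z, U z -> derivable f z 1.

Definition punctured_plane (R : realType) : set (Cplx R) :=
  [set z | z != 0].

(* U is not assumed connected, and 0 is not in U since cexp never vanishes. *)
Definition log_branch (R : realType) (U : set (Cplx R))
    (L : Cplx R -> Cplx R) : Prop :=
  [/\ open U, holomorphic_on U L & forall z, U z -> cexp (L z) = z].

Definition cpow (R : realType) (L : Cplx R -> Cplx R) (b z : Cplx R) : Cplx R :=
  cexp (b * L z).

Definition solves_on (R : realType) (n lam mu : Cplx R) (U : set (Cplx R))
    (E : Cplx R -> Cplx R) : Prop :=
  [/\ holomorphic_on U E, holomorphic_on U (derive1 E) &
    forall z, U z ->
      z ^+ 2 * derive1 (derive1 E) z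
      + (n * z + mu * (1 - z ^+ 2)) * derive1 E z
      + (lam - mu * n * z) * E z = 0].

(* The multivalued function E(z) = z^b f(z) on the punctured plane is given by
   its branches [fun z => cpow L b z * f z], one for every branch L of the
   logarithm on an open set. It is a solution if all its branches are. *)
Definition monodromy_eigenfunction (R : realType) (n lam mu b : Cplx R)
    (f : Cplx R -> Cplx R) : Prop :=
  [/\ holomorphic_on (@punctured_plane R) f,
      forall U L, log_branch U L ->
        solves_on n lam mu U (fun z => cpow L b z * f z) &
      exists U L z, [/\ log_branch U L, U z & cpow L b z * f z != 0]].

Definition mx2 (R : realType) (a11 a12 a21 a22 : Cplx R) : 'M[Cplx R]_2 :=
  \matrix_(i, j) if i == 0 then (if j == 0 then a11 else a12)
                 else (if j == 0 then a21 else a22).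

Definition matM (R : realType) (n lam mu b : Cplx R) (k : nat) :
    'M[Cplx R]_2 :=
  let d := (k%:R + b) * (k%:R + b + n - 1) in
  mx2 (1 + lam / d) (mu ^+ 2 / d)
      1             0.

Definition matS (R : realType) (n lam mu b : Cplx R) (m : nat) :
    'M[Cplx R]_2 :=
  let c := b - m%:R in
  mx2 (1 + (lam - n + 2) / ((c + 1) * (c + n - 2)))
      (mu ^+ 2 * (c + n - 1) / ((c + 1) * (c + n - 2) * (c + n - 3)))
      1
      0.

(* A k *m A k.+1 *m A k.+2 *m ..., in this order. *)
Definition mxprod_from (R : realType) (A : nat -> 'M[Cplx R]_2) (k : nat) :
    'M[Cplx R]_2 :=
  lim ((fun N => \prod_(k <= j < N) A j) @ \oo).

Definition matR (R : realType) (n lam mu b : Cplx R) (k : nat) :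
    'M[Cplx R]_2 := mxprod_from (matM n lam mu b) k.

Definition matT (R : realType) (n lam mu b : Cplx R) (m : nat) :
    'M[Cplx R]_2 := mxprod_from (matS n lam mu b) m.

(* Main.v *)
Require Import Defs.
From HB Require Import structures.
From mathcomp Require Import all_boot all_order all_algebra.
From mathcomp Require Import all_classical all_reals all_analysis.
From mathcomp Require Import complex ring lra zify.
Set Implicit Arguments.
Unset Strict Implicit.
Unset Printing Implicit Defensive.
Import Order.TTheory GRing.Theory Num.Theory.
Import numFieldNormedType.Exports.
Local Open Scope ring_scope.
Local Open Scope complex_scope.
Local Open Scope classical_set_scope.

(* A Laurent series z^b * sum_k a_k z^k solves the equation iff a satisfies the three-term
   recurrence [recurrence] below. After rescaling a by Gamma-like weights, the recurrence read
   towards +oo, resp. -oo, is driven by the companion matrices M_k, resp. S_m, and the first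
   columns of R_1 and T_0 are the values at k = 0, 1 of the solutions that decay
   superexponentially on that side; the stated identity says that these two match up to a
   constant. If they match, the glued sequence gives a holomorphic f on C^*. Conversely, the
   Fourier coefficients of f on the circle through a point where f does not vanish satisfy the
   recurrence, are bounded and are not all zero (so neither Cauchy's theorem nor analyticity is
   needed); any sequence of at most exponential growth must be the decaying solution on each
   side, because its Casoratian with the decaying one would otherwise grow factorially. *)

(** The matrices [M_k] and [S_m] do not tend to the identity but to the rank-one matrix with both
    rows (1, 0), so the products are not perturbations of the identity. What is stable is the sum of
    the two entries of the first row of a partial product: a further factor changes it by the first
    entry times the deviation of that factor's first row from (1, 0), a deviation of size O(1/k^2)
    that telescopes against const/(k+1). In the limit the second column vanishes, which is why only
    first columns enter the criterion, and the first column is (alpha_k, alpha_(k+1)) for a solution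
    with alpha tending to 1. Derivatives are organised around theta = z d/dz. It acts diagonally on
    the powers z^(b+k), and along a circle the derivative in the angle is i theta, so circle
    integrals of theta phi vanish by the fundamental theorem of calculus. The conditions on b and b
    + n keep both outer coefficients of the recurrence away from zero, so two consecutive values
    determine a whole sequence in both directions. *)

Section caratheodory.
Variable K : numFieldType.
Implicit Types f g F : K -> K.

(** Carathéodory's form of the derivative: the difference quotient is completed at [x] by the
    derivative. Chain rules then become algebra, with no division by a possibly vanishing
    increment. *)
Lemma is_derive_slope f (x a : K) : is_derive x 1 f a ->
  exists F, [/\ forall z, f z - f x = F z * (z - x), F z @[z --> x] --> F x & F x = a].
Proof.
case=> fx <-; exists (fun z => if z == x then 'D_1 f x else (f z - f x) / (z - x)).
rewrite eqxx; split=> // [z|].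
  by case: eqP => [->|/eqP]; [rewrite !subrr mulr0|rewrite -subr_eq0 => /divfK->].
have : {for x, continuous (fun z => if z == x then 'D_1 f x else (f z - f x) / (z - x))}.
  apply/continuous_withinNshiftx; rewrite eqxx /=.
  apply: cvg_trans (fx : _ --> 'D_1 f x); apply: near_eq_cvg.
  rewrite near_withinE; apply: nearW => h h0 /=.
  by rewrite -subr_eq0 addrK (negPf h0) [_%:A]mulr1 [LHS]mulrC.
by rewrite /prop_for /continuous_at eqxx.
Qed.

Lemma slope_is_derive f F (x a : K) :
  (\forall z \near x, f z - f x = F z * (z - x)) -> F z @[z --> x] --> a ->
  is_derive x 1 f a.
Proof.
move=> fF Fa.
suff H : h^-1 *: ((f \o shift x) h%:A - f x) @[h --> 0^'] --> a.
  by constructor; [apply/cvg_ex; exists a|apply: cvg_lim].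
have sh0 : h + x @[h --> 0^'] --> x.
  rewrite -[X in _ --> X]add0r.
  have h0 : h @[h --> (0:K)^'] --> (0 : K) by exact: cvg_within.
  exact: (cvgD h0 (cvg_cst x)).
apply: cvg_trans (cvg_comp _ _ sh0 Fa); apply: near_eq_cvg.
have H : \forall h \near 0^', f (h + x) - f x = F (h + x) * (h + x - x) by exact: sh0 _ fF.
near=> h.
have h0 : h != 0 by near: h; exact: nbhs_dnbhs_neq.
have fh : f (h + x) - f x = F (h + x) * (h + x - x) by near: h.
rewrite /= [_%:A]mulr1 fh addrK.
by rewrite [RHS]mulrC mulfK.
Unshelve. all: by end_near. Qed.
End caratheodory.

(** * Modulus, limits and series in the complex plane, reduced to real ones *)

Section Cplx_topology.
Variable R : realType.
Local Notation C := (Cplx R).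

Lemma lerC (x y : R) : ((x%:C : C) <= y%:C) = (x <= y). Proof. exact: lecR. Qed.

Lemma ltrC (x y : R) : ((x%:C : C) < y%:C) = (x < y). Proof. exact: ltcR. Qed.

(** The order of [Cplx R] compares only numbers with equal imaginary parts, so every epsilon of a
    complex limit is in fact real. *)
Lemma Cplx_gt0 (e : C) : 0 < e -> exists2 r : R, 0 < r & e = r%:C.
Proof. by case: e => a c; rewrite ltcE /= => /andP[/eqP-> a0]; exists a. Qed.

Lemma normc_le_ReIm (z : C) : `|z| <= (`|complex.Re z| + `|complex.Im z|)%:C.
Proof.
rewrite normc_def lerC -(ler_pXn2r (n := 2)) ?nnegrE ?sqrtr_ge0 ?addr_ge0 //.
rewrite sqr_sqrtr ?addr_ge0 ?sqr_ge0 // sqrrD !real_normK ?num_real //.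
by rewrite -addrA lerD2l lerDr mulrn_wge0 // mulr_ge0.
Qed.

Lemma normc_ge_Im (z : C) : `|complex.Im z|%:C <= `|z|.
Proof.
by rewrite normc_def lerC -sqrtr_sqr ler_wsqrtr // lerDr sqr_ge0.
Qed.

(** The norm of [Cplx R] takes its values in [Cplx R]; this real-valued copy brings estimates within
    reach of [lra], [nra] and the squeeze and comparison lemmas for real sequences. *)
Definition cabs (z : C) : R := complex.Re `|z|.

Lemma normE (z : C) : `|z| = (cabs z)%:C.
Proof. by rewrite /cabs RRe_real // normr_real. Qed.

Lemma cabs_ge0 (z : C) : 0 <= cabs z.
Proof. by have := normr_ge0 z; rewrite normE lerC. Qed.

Lemma cabsM (z w : C) : cabs (z * w) = cabs z * cabs w.
Proof. by have := normrM z w; rewrite !normE -rmorphM => /complexI. Qed.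

Lemma cabsD (z w : C) : cabs (z + w) <= cabs z + cabs w.
Proof. by have := ler_normD z w; rewrite !normE -rmorphD lerC. Qed.

Lemma cabsN (z : C) : cabs (- z) = cabs z.
Proof. by rewrite /cabs normrN. Qed.

Lemma cabsB (z w : C) : cabs (z - w) <= cabs z + cabs w.
Proof. by rewrite -(cabsN w) cabsD. Qed.

Lemma cabs0 : cabs (0 : C) = 0. Proof. by rewrite /cabs normr0. Qed.

Lemma cabs1 : cabs (1 : C) = 1. Proof. by rewrite /cabs normr1. Qed.

Lemma cabs_eq0 (z : C) : (cabs z == 0) = (z == 0).
Proof. by have := normr_eq0 z; rewrite normE => <-; rewrite eq_complex /= eqxx andbT. Qed.

Lemma cabs_gt0 (z : C) : (0 < cabs z) = (z != 0).
Proof. by rewrite lt_def cabs_eq0 cabs_ge0 andbT. Qed.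

Lemma cabsV (z : C) : cabs z^-1 = (cabs z)^-1.
Proof. by have := normfV z; rewrite !normE -fmorphV => /complexI. Qed.

Lemma cabsX (z : C) k : cabs (z ^+ k) = cabs z ^+ k.
Proof. by have := normrX k z; rewrite !normE -rmorphXn => /complexI. Qed.

Lemma cabs_nat k : cabs (k%:R : C) = k%:R.
Proof. by have := normr_nat C k; rewrite normE -(rmorph_nat (real_complex R)) => /complexI. Qed.

Lemma cvg_cabs (T : Type) (F : set_system T) (FF : Filter F) (f : T -> C) (l : C) :
  cabs (f t - l) @[t --> F] --> (0 : R) -> f @ F --> l.
Proof.
move=> /cvgr0Pnorm_lt H; apply/cvgrPdist_lt => _ /Cplx_gt0[r r0 ->].
apply: filterS (H _ r0) => t; rewrite ger0_norm ?cabs_ge0 //.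
by rewrite distrC normE ltrC.
Qed.

Lemma cvg_Cplx (T : Type) (F : set_system T) (FF : Filter F) (f : T -> C) (l : C) :
  (fun t => complex.Re (f t)) @ F --> complex.Re l ->
  (fun t => complex.Im (f t)) @ F --> complex.Im l -> f @ F --> l.
Proof.
move=> /cvgrPdist_lt hre /cvgrPdist_lt him; apply/cvgrPdist_lt => _ /Cplx_gt0[r r0 ->].
have r20 : 0 < r / 2 by rewrite divr_gt0.
near=> t.
have h1 : `|complex.Re l - complex.Re (f t)| < r / 2 by near: t; exact: hre.
have h2 : `|complex.Im l - complex.Im (f t)| < r / 2 by near: t; exact: him.
apply: le_lt_trans (normc_le_ReIm _) _.
rewrite ltrC -!raddfB /= in h1 h2 *.
by rewrite (splitr r) ltrD.
Unshelve. all: by end_near. Qed.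

Lemma continuous_Re : continuous (@complex.Re R : C -> R).
Proof.
move=> z; apply/(@cvgrPdist_lt _ _ _ (nbhs z)) => e e0.
have /cvgrPdist_lt/(_ e%:C) : t @[t --> z] --> z by exact: cvg_id.
rewrite ltrC => /(_ e0) H; near=> t.
have h : `|z - t| < e%:C by near: t.
rewrite -raddfB.
by rewrite -ltrC; apply: le_lt_trans h; exact: normc_ge_Re.
Unshelve. all: by end_near. Qed.

Lemma continuous_Im : continuous (@complex.Im R : C -> R).
Proof.
move=> z; apply/(@cvgrPdist_lt _ _ _ (nbhs z)) => e e0.
have /cvgrPdist_lt/(_ e%:C) : t @[t --> z] --> z by exact: cvg_id.
rewrite ltrC => /(_ e0) H; near=> t.
have h : `|z - t| < e%:C by near: t.
rewrite -raddfB.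
by rewrite -ltrC; apply: le_lt_trans h; exact: normc_ge_Im.
Unshelve. all: by end_near. Qed.

Definition cconj (z : C) : C := conjc z.

Lemma cconjB (z w : C) : cconj (z - w) = cconj z - cconj w.
Proof. exact: (rmorphB (@conjc R)). Qed.

Lemma cconjM (z w : C) : cconj (z * w) = cconj z * cconj w.
Proof. exact: (rmorphM (@conjc R)). Qed.

Lemma cconjX (z : C) k : cconj (z ^+ k) = cconj z ^+ k.
Proof. exact: (rmorphXn (@conjc R)). Qed.

Lemma cconjV (z : C) : cconj z^-1 = (cconj z)^-1.
Proof. exact: conjc_inv. Qed.

Lemma cconjK : involutive cconj.
Proof. exact: conjcK. Qed.

Lemma mul_cconj (z : C) : z * cconj z = (cabs z ^+ 2)%:C.
Proof.
case: z => x y; rewrite /cabs normc_def /= sqr_sqrtr ?addr_ge0 ?sqr_ge0 //.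
by apply/eqP; rewrite eq_complex /=; apply/andP; split; apply/eqP; ring.
Qed.

Lemma continuous_cabs : continuous (cabs : C -> R).
Proof.
move=> z; apply/(@cvgrPdist_lt _ _ _ (nbhs z)) => e e0.
have /cvgrPdist_lt/(_ e%:C) : t @[t --> z] --> z by exact: cvg_id.
rewrite ltrC => /(_ e0) H; near=> t.
have h : `|z - t| < e%:C by near: t.
rewrite normE ltrC in h; apply: le_lt_trans h.
rewrite ler_norml; have := cabsD (z - t) t; have := cabsD (t - z) z.
rewrite !subrK -(cabsN (t - z)) opprB => h1 h2; apply/andP; split; lra.
Unshelve. all: by end_near. Qed.

Lemma continuous_real_complex : continuous (real_complex R : R -> C).
Proof. by move=> x; apply: cvg_Cplx; [exact: cvg_id|exact: cvg_cst]. Qed.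

(** Completeness is invoked only for the reals: the real and imaginary parts of the series converge
    absolutely by comparison with [v]. *)
Lemma cvg_normed_series (u : nat -> C) (v : nat -> R) :
  (forall k, cabs (u k) <= v k) -> cvgn (series v) -> cvgn (series u).
Proof.
move=> uv' cv; have uv k : `|u k| <= (v k)%:C by rewrite normE lerC.
have H (p : C -> R) : (forall z : C, `|p z|%:C <= `|z|) -> cvgn (series (p \o u)).
  move=> hp; apply: (@normed_cvg _ R^o); apply: series_le_cvg cv => k /=.
  - exact: normr_ge0.
  - by rewrite -lerC; exact: (le_trans (normr_ge0 (u k)) (uv k)).
  - by rewrite -lerC; apply: le_trans (hp _) _; exact: uv.
have /cvg_ex[a ha] := H (@complex.Re R) (@normc_ge_Re _).
have /cvg_ex[c hc] := H (@complex.Im R) normc_ge_Im.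
apply/cvg_ex; exists (a +i* c); apply: cvg_Cplx => /=.
  by apply: cvg_trans ha; apply: near_eq_cvg; apply: nearW => k; rewrite !seriesEnat /= raddf_sum.
by apply: cvg_trans hc; apply: near_eq_cvg; apply: nearW => k; rewrite !seriesEnat /= raddf_sum.
Qed.

End Cplx_topology.

(** * Slopes, curves and the complex exponential *)

Section chain_rule.
Variable K : numFieldType.
Implicit Types f g F : K -> K.

Lemma is_derive_cvg f (x a : K) : is_derive x 1 f a -> f z @[z --> x] --> f x.
Proof. by case=> /derivable1_diffP/differentiable_continuous. Qed.

Lemma is_derive_comp f g (x a c : K) : is_derive (g x) 1 f a -> is_derive x 1 g c ->
  is_derive x 1 (f \o g) (a * c).
Proof.
move=> df dg; have gx := is_derive_cvg dg.
have [F [fF cF <-]] := is_derive_slope df; have [G [gG cG <-]] := is_derive_slope dg.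
apply: (@slope_is_derive _ _ (fun z => F (g z) * G z)).
  by near=> z; rewrite /= fF gG mulrA.
exact: (cvgM (cvg_comp _ _ gx cF) cG).
Unshelve. all: by end_near. Qed.

(** With [F] the slope of [f] at [g x], the identity f (g z) = z reads F (g z) * (g z - g x) = z -
    x, so 1 / F (g z) is a slope of [g]. Applied to branches of the logarithm. *)
Lemma is_derive_right_inverse f g (x a : K) : is_derive (g x) 1 f a -> a != 0 ->
  (\forall z \near x, f (g z) = z) -> g z @[z --> x] --> g x -> is_derive x 1 g a^-1.
Proof.
move=> df a0 fg gx; have fgx := nbhs_singleton fg.
have [F [fF cF Fa]] := is_derive_slope df.
have cFg : F (g z) @[z --> x] --> a by rewrite -Fa; exact: (cvg_comp _ _ gx cF).
apply: (@slope_is_derive _ _ (fun z => (F (g z))^-1)); last exact: (cvgV a0 cFg).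
near=> z.
have Fz : F (g z) != 0 by near: z; move: cFg => /cvgr_neq0; apply.
have fgz : f (g z) = z by near: z.
by have := fF (g z); rewrite fgz fgx => ->; rewrite mulKf.
Unshelve. all: by end_near. Qed.

End chain_rule.

Section curves.
Variable R : realType.
Local Notation C := (Cplx R).
Implicit Types (g : R -> C) (v : C) (t : R).

(** The scalars of [Cplx R] are the complex numbers, so the derivative with respect to a real
    parameter is taken componentwise. *)
Definition is_velocity t g v :=
  is_derive t 1 (fun s => complex.Re (g s)) (complex.Re v) /\
  is_derive t 1 (fun s => complex.Im (g s)) (complex.Im v).

Lemma velocity_slope t g v : is_velocity t g v -> exists G : R -> C,
  [/\ forall s, g s - g t = G s * (s - t)%:C, G s @[s --> t] --> G t & G t = v].
Proof.
move=> [/is_derive_slope[A [gA cA Av]] /is_derive_slope[B [gB cB Bv]]].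
exists (fun s => A s +i* B s); split; last by rewrite Av Bv; case: (v).
  move=> s; apply/eqP; rewrite eq_complex /= !mulr0 subr0 add0r -gA -gB.
  by case: (g s) => ? ?; case: (g t) => ? ? /=; rewrite !eqxx.
exact: cvg_Cplx.
Qed.

Lemma slope_velocity t g v (G : R -> C) :
  (forall s, g s - g t = G s * (s - t)%:C) -> G s @[s --> t] --> v -> is_velocity t g v.
Proof.
move=> gG cG.
split.
- apply: (@slope_is_derive _ _ (fun s => complex.Re (G s))); last exact: (cvg_comp _ _ cG
  (@continuous_Re R v)).
  near=> s => /=; move/(congr1 (@complex.Re R)): (gG s).
  by case: (g s) => ? ?; case: (g t) => ? ? /=; case: (G s) => ? ? /=; rewrite mulr0 subr0.
- apply: (@slope_is_derive _ _ (fun s => complex.Im (G s))); last exact: (cvg_comp _ _ cG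
  (@continuous_Im R v)).
  near=> s => /=; move/(congr1 (@complex.Im R)): (gG s).
  by case: (g s) => ? ?; case: (g t) => ? ? /=; case: (G s) => ? ? /=; rewrite mulr0 add0r.
Unshelve. all: by end_near. Qed.

Lemma velocity_cvg t g v : is_velocity t g v -> g s @[s --> t] --> g t.
Proof. by move=> [/is_derive_cvg h1 /is_derive_cvg h2]; exact: cvg_Cplx. Qed.

Lemma velocity_comp t g v (f : C -> C) (d : C) : is_derive (g t) 1 f d -> is_velocity t g v ->
  is_velocity t (f \o g) (d * v).
Proof.
move=> df dg; have gt := velocity_cvg dg.
have [F [fF cF <-]] := is_derive_slope df; have [G [gG cG <-]] := velocity_slope dg.
apply: (@slope_velocity _ _ _ (fun s => F (g s) * G s)).
  by move=> s /=; rewrite fF gG mulrA.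
exact: (cvgM (cvg_comp _ _ gt cF) cG).
Qed.

End curves.

Section complex_exponential.
Variable R : realType.
Local Notation C := (Cplx R).

Lemma cexp0 : cexp (0 : C) = 1.
Proof. by rewrite /cexp /= expR0 cos0 sin0 !mulr1 mulr0. Qed.

Lemma cexpD (z w : C) : cexp (z + w) = cexp z * cexp w.
Proof.
case: z w => a c [d e]; rewrite /cexp /= expRD cosD sinD.
apply/eqP; rewrite eq_complex /=; apply/andP; split; apply/eqP; ring.
Qed.

Lemma cexp_neq0 (z : C) : cexp z != 0.
Proof.
apply/eqP => h; have := cexpD z (- z); rewrite subrr cexp0 h mul0r => /eqP.
by rewrite oner_eq0.
Qed.

Lemma cexpN (z : C) : cexp (- z) = (cexp z)^-1.
Proof.
apply: (mulfI (cexp_neq0 z)); rewrite -cexpD subrr cexp0 divff //; exact: cexp_neq0.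
Qed.

Let real_slope (f : R -> R) (x a : R) : is_derive x 1 f a -> exists F : R -> R,
  [/\ forall z, f z - f x = F z * (z - x), F z @[z --> x] --> F x & F x = a].
Proof. exact: is_derive_slope. Qed.

Lemma is_derive_cexp (z : C) : is_derive z 1 (@cexp R) (cexp z).
Proof.
have [A [hA cA A1]] := real_slope (is_derive_expR (0 : R)).
have [B [hB cB B0]] := real_slope (is_derive_cos (0 : R)).
have [S [hS cS S1]] := real_slope (is_derive_sin (0 : R)).
have [F [hF cF]] : exists F : C -> C, (forall h, cexp h - 1 = F h * h) /\ F h @[h --> (0 : C)]
  --> (1 : C).
  exists (fun h => if h == 0 then 1 else (cexp h - 1) / h); split.
    by move=> h; case: eqP => [->|/eqP h0]; [rewrite cexp0 subrr mulr0|rewrite divfK].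
  (* For h = x + iy the slopes at 0 give cexp h - 1 - h = P h * x + Q h * y. As |x| and |y| are at
     most |h|, the error of the difference quotient is at most |P h| + |Q h|, and both tend to 0. *)
  pose P (h : C) : C := (A (complex.Re h) - 1)%:C.
  pose Q (h : C) : C := (expR (complex.Re h))%:C * (B (complex.Im h) +i* S (complex.Im h)) - 'i%C.
  have re0 : (fun h : C => complex.Re h) @ (0 : C) --> (0 : R) by exact: (@continuous_Re R 0).
  have im0 : (fun h : C => complex.Im h) @ (0 : C) --> (0 : R) by exact: (@continuous_Im R 0).
  have cP : P h @[h --> (0 : C)] --> ((A 0 - 1)%:C : C).
    have cA1 : (fun h : C => A (complex.Re h) - 1) @ (0 : C) --> A 0 - 1.
      by have cA' := cvg_comp _ _ re0 cA; exact: (cvgB cA' (cvg_cst (1 : R))).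
    exact: (cvg_comp _ _ cA1 (@continuous_real_complex R (A 0 - 1))).
  rewrite A1 expR0 subrr in cP.
  have cQ : Q h @[h --> (0 : C)] --> ((expR 0)%:C * (B 0 +i* S 0) - 'i%C : C).
    have cE := cvg_comp _ _ (cvg_comp _ _ re0 (@continuous_expR R 0)) (@continuous_real_complex R
      _).
    have cB' := cvg_comp _ _ im0 cB; have cS' := cvg_comp _ _ im0 cS.
    have cBS : (fun h : C => B (complex.Im h) +i* S (complex.Im h)) @ (0 : C) --> (B 0 +i* S 0 : C).
      exact: (@cvg_Cplx R C (nbhs (0 : C)) _ (fun h => B (complex.Im h) +i* S (complex.Im h)) (B
        0 +i* S 0) cB' cS').
    exact: (cvgB (cvgM cE cBS) (cvg_cst ('i%C : C))).
  rewrite expR0 B0 S1 sin0 cos0 oppr0 mul1r subrr in cQ.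
  have PQ h : h != 0 -> `|1 - (cexp h - 1) / h| <= `|P h| + `|Q h|.
    move=> h0; have -> : 1 - (cexp h - 1) / h =
        - (P h * ((complex.Re h)%:C / h) + Q h * ((complex.Im h)%:C / h)).
      apply: (mulIf h0); rewrite mulrBl mul1r divfK // mulNr mulrDl -!mulrA mulVf // !mulr1.
      rewrite /P /Q {h0}; case: h => x y; have := hA x; have := hB y; have := hS y.
      rewrite expR0 cos0 sin0 !subr0 => eS /(canRL (subrK _)) eB /(canRL (subrK _)) eA.
      rewrite /cexp /= eS eB eA.
      apply/eqP; rewrite eq_complex /=; apply/andP; split; apply/eqP; ring.
    rewrite normrN; apply: le_trans (ler_normD _ _) _.
    rewrite !normrM !normfV lerD // ler_piMr // ler_pdivrMr ?normr_gt0 // mul1r.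
      by rewrite normc_def /= expr0n addr0 sqrtr_sqr; exact: normc_ge_Re.
    by rewrite normc_def /= expr0n addr0 sqrtr_sqr; exact: normc_ge_Im.
  apply/(@cvgrPdist_lt _ _ _ (nbhs (0 : C))) => e e0.
  have e20 : 0 < e / 2 by rewrite divr_gt0.
  move/cvgr0_norm_lt: cP => /(_ _ e20) cP; move/cvgr0_norm_lt: cQ => /(_ _ e20) cQ.
  near=> h; case: eqP => [_|/eqP h0]; first by rewrite subrr normr0.
  apply: le_lt_trans (PQ _ h0) _; rewrite (splitr e) ltrD //; near: h; [exact: cP|exact: cQ].
apply: (@slope_is_derive _ _ (fun w => cexp z * F (w - z))).
  near=> w; rewrite -mulrA -hF mulrBr mulr1 -cexpD; congr (cexp _ - _); ring.
have cz : w - z @[w --> z] --> (0 : C) by rewrite -(subrr z); exact: (cvgB cvg_id (cvg_cst _)).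
have := cvgM (cvg_cst (cexp z)) (cvg_comp _ _ cz cF).
rewrite mulr1 => H; exact: H.
Unshelve. all: by end_near. Qed.
End complex_exponential.

(** * Branches of the logarithm *)

Section logarithm.
Variable R : realType.
Local Notation C := (Cplx R).

(** Meant for the right half-plane x > 0, where x * sqrt(1 + (y/x)^2) is the modulus and atan (y/x)
    the argument. *)
Definition principal_log (z : C) : C :=
  let: x +i* y := z in ln (x * Num.sqrt (1 + (y / x) ^+ 2)) +i* atan (y / x).

Lemma cexp_principal_log (z : C) : 0 < complex.Re z -> cexp (principal_log z) = z.
Proof.
case: z => x y /= x0; rewrite /cexp /=.
have s0 : 0 < Num.sqrt (1 + (y / x) ^+ 2).
  by rewrite sqrtr_gt0 ltr_pwDl // sqr_ge0.
have c0 : cos (atan (y / x)) != 0 by rewrite cos_atan invr_neq0 // gt_eqF.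
have -> : sin (atan (y / x)) = y / x * cos (atan (y / x)).
  by rewrite -{2}(atanK (y / x)) /tan divfK.
rewrite lnK ?posrE ?mulr_gt0 // cos_atan.
apply/eqP; rewrite eq_complex /=; apply/andP; split; apply/eqP.
  by rewrite mulfK // gt_eqF.
rewrite [_ / x * _]mulrC mulrA mulfK ?gt_eqF // mulrC divfK // gt_eqF //.
Qed.

Lemma continuous_principal_log (z : C) : 0 < complex.Re z ->
  principal_log w @[w --> z] --> principal_log z.
Proof.
move=> z0; have zx0 : complex.Re z != 0 by rewrite gt_eqF.
have Fz : Filter (nbhs z) by exact: nbhs_filter.
pose q (w : C) : R := complex.Im w / complex.Re w.
pose m (w : C) : R := complex.Re w * Num.sqrt (1 + q w ^+ 2).
have cre : (fun w : C => complex.Re w) @ z --> complex.Re z by exact: (@continuous_Re R z).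
have cim : (fun w : C => complex.Im w) @ z --> complex.Im z by exact: (@continuous_Im R z).
have cq : q @ z --> q z by have c1 := cvgV (FF := Fz) zx0 cre; exact: (cvgM (FF := Fz) cim c1).
have cm : m @ z --> m z.
  have cq2 := cvgD (FF := Fz) (cvg_cst (FF := Fz) (1 : R)) (cvgM (FF := Fz) cq cq).
  have csq := cvg_comp _ _ cq2 (@sqrt_continuous R _).
  exact: (cvgM (FF := Fz) cre csq).
have m0 : 0 < m z.
  by rewrite mulr_gt0 // sqrtr_gt0 ltr_pwDl // sqr_ge0.
have cln := cvg_comp _ _ cm (continuous_ln m0).
have cat := cvg_comp _ _ cq (@continuous_atan R _).
have E (w : C) : principal_log w = ln (m w) +i* atan (q w) by case: w.
rewrite E; under eq_fun do rewrite E.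
exact: (@cvg_Cplx R C (nbhs z) Fz (fun w => ln (m w) +i* atan (q w)) (ln (m z) +i* atan (q z))
  cln cat).
Qed.

(** A multiple of a quarter turn moves any nonzero point into the right half-plane, the domain of
    [principal_log]; this yields a branch of the logarithm near every point. *)
Lemma exists_cexp_Re_gt0 (z : C) : z != 0 -> exists w : C, 0 < complex.Re (z / cexp w).
Proof.
case: z => x y z0.
have hpi : cexp (0 +i* (pi / 2) : C) = 'i%C.
  by rewrite /cexp /= expR0 cos_pihalf sin_pihalf !mul1r.
have re (u v : C) : complex.Re (u * v) = complex.Re u * complex.Re v - complex.Im u * complex.Im v.
  by case: u v => ? ? [].
have [x0|x0|x0] := ltgtP x 0.
- exists ((0 +i* (pi / 2)) *+ 2); rewrite mulr2n cexpD hpi.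
  have -> : ('i%C * 'i%C : C) = -1 by rewrite -expr2 sqr_i.
  by rewrite invrN invr1 mulrN1 /= oppr_gt0.
- by exists 0; rewrite cexp0 divr1.
- have [y0|y0|y0] := ltgtP y 0.
  + exists (- (0 +i* (pi / 2))); rewrite cexpN hpi invrK re /= x0 mul0r mulr1 add0r oppr_gt0 //.
  + exists (0 +i* (pi / 2)); rewrite hpi.
    have hi : ('i%C : C)^-1 = - 'i%C.
      have i0 : ('i%C : C) != 0 by rewrite -hpi; exact: cexp_neq0.
      by apply: (mulIf i0); rewrite mulVf // mulNr -expr2 sqr_i opprK.
    by rewrite hi re /= x0 mul0r mulrN1 opprK add0r.
  + by move: z0; rewrite x0 y0 eqxx.
Qed.

Lemma log_branch_at (z0 : C) : z0 != 0 -> exists U L, log_branch U L /\ U z0.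
Proof.
move=> /exists_cexp_Re_gt0[w zw].
pose c : C := cexp w; have c0 : c != 0 := cexp_neq0 w.
pose U : set C := [set z : C | 0 < complex.Re (z / c)].
pose L (z : C) := w + principal_log (z / c).
have cUz (z : C) : (fun x : C => x / c) @ z --> z / c by exact: (@mulrr_continuous _ c^-1 z).
have oU : open U.
  rewrite openE => z Uz.
  have := cvg_comp _ _ (cUz z) (@continuous_Re R (z / c)).
  by move=> /cvgr_gt; apply.
have expL z : U z -> cexp (L z) = z.
  by move=> Uz; rewrite cexpD cexp_principal_log // mulrC divfK.
exists U, L; split => //; split => // z Uz.
have := @is_derive_right_inverse C (@cexp R) L z _ (is_derive_cexp (L z)) (cexp_neq0 _).
case=> //.
  by have : nbhs z U by [exact: open_nbhs_nbhs]; apply: filterS.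
have cpl := cvg_comp _ _ (cUz z) (continuous_principal_log Uz).
exact: (cvgD (FF := nbhs_filter z) (cvg_cst (FF := nbhs_filter z) w) cpl).
Qed.

Lemma is_derive_log_branch (U : set C) (L : C -> C) (z : C) : log_branch U L -> U z ->
  is_derive z 1 L z^-1.
Proof.
move=> [oU hL expL] Uz; have dL : is_derive z 1 L ('D_1 L z) := derivableP (hL z Uz).
have := is_derive_comp (is_derive_cexp (L z)) dL.
rewrite expL // => dc.
have did : is_derive z 1 (@cexp R \o L) 1.
  apply: (@near_eq_is_derive C C C id) (is_derive_id z 1).
  by apply: filterS (open_nbhs_nbhs (conj oU Uz)) => w Uw /=; rewrite expL.
have e : z * 'D_1 L z = 1 by case: dc => _ <-; case: did.
have z0 : z != 0 by apply/eqP => zz; move/eqP: e; rewrite zz mul0r eq_sym oner_eq0.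
rewrite (_ : z^-1 = 'D_1 L z) //; apply: (mulfI z0); by rewrite e divff.
Qed.

Lemma is_derive_cpow (U : set C) (L : C -> C) (b z : C) : log_branch U L -> U z ->
  is_derive z 1 (cpow L b) (b / z * cpow L b z).
Proof.
move=> hL Uz; have dL := is_derive_log_branch hL Uz.
have dbL : is_derive z 1 (fun w => b * L w) (b * z^-1) by exact: is_deriveZ.
by rewrite mulrC; exact: (@is_derive_comp C (@cexp R) (fun w => b * L w) z _ _ (is_derive_cexp (b
  * L z)) dbL).
Qed.

Lemma cpow_neq0 (L : C -> C) (b z : C) : cpow L b z != 0.
Proof. exact: cexp_neq0. Qed.

End logarithm.

(** * Infinite products of companion matrices *)

Lemma cvg_mx (K : numFieldType) (T : Type) (F : set_system T) (FF : Filter F) m n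
    (f : T -> 'M[K]_(m, n)) (M : 'M[K]_(m, n)) :
  (forall i j, f t i j @[t --> F] --> M i j) -> f @ F --> M.
Proof.
move=> fM; apply/cvg_ballP => e e0.
have H (ij : 'I_m * 'I_n) : \forall t \near F, ball (M ij.1 ij.2) e (f t ij.1 ij.2).
  by have /cvg_ballP := fM ij.1 ij.2; apply.
have H' := filter_forall _ H.
near=> t; split=> // i j; have Ht : forall ij : 'I_m * 'I_n, ball (M ij.1 ij.2) e (f t ij.1 ij.2)
  by near: t; exact: H'.
exact: (Ht (i, j)).
Unshelve. all: by end_near.
Qed.

Section companion_products.
Variables (R : realType).
Local Notation C := (Cplx R).
Variables (A : nat -> 'M[C]_2) (c : nat -> R) (j0 : nat).
Hypothesis A10 : forall j, A j 1 0 = 1.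
Hypothesis A11 : forall j, A j 1 1 = 0.
Hypothesis c0 : c j @[j --> \oo] --> (0 : R).
(** [c k] majorises the tail from [k] on of the deviations of the first rows from (1, 0); stating
    this through differences makes all later sums telescope. *)
Hypothesis Ac : forall j, (j0 <= j)%N -> cabs (A j 0 0 - 1) + cabs (A j 0 1) <= c j - c j.+1.

Let P k N := \prod_(k <= j < N) A j.

Let PS k N : (k <= N)%N -> P k N.+1 = P k N * A N.
Proof. by move=> kN; rewrite /P big_nat_recr. Qed.

Let Pk k : P k k = 1. Proof. by rewrite /P big_geq. Qed.

Let mx2M (B D : 'M[C]_2) i j : (B * D) i j = B i 0 * D 0 j + B i 1 * D 1 j.
Proof. by rewrite /GRing.mul /= mxE !big_ord_recl big_ord0 addr0; congr (_ + B i _ * D _ j);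
  apply/val_inj. Qed.

Let PS0 k N i : (k <= N)%N -> P k N.+1 i 0 = P k N i 0 * A N 0 0 + P k N i 1.
Proof. by move=> kN; rewrite PS // mx2M A10 mulr1. Qed.

Let PS1 k N i : (k <= N)%N -> P k N.+1 i 1 = P k N i 0 * A N 0 1.
Proof. by move=> kN; rewrite PS // mx2M A11 mulr0 addr0. Qed.

Let Sk k N : (k < N)%N -> P k N = A k * P k.+1 N.
Proof. by move=> kN; rewrite /P big_ltn. Qed.

Let PS10 k N i : (k < N)%N -> P k N 1 i = P k.+1 N 0 i.
Proof. by move=> kN; rewrite Sk // mx2M A10 A11 mul1r mul0r addr0. Qed.

Let P00 m N : (m.+1 < N)%N -> P m N 0 0 = A m 0 0 * P m.+1 N 0 0 + A m 0 1 * P m.+2 N 0 0.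
Proof. by move=> mN; rewrite Sk 1?ltnW // mx2M PS10. Qed.

Let c_ni k : (j0 <= k)%N -> 0 <= c k - c k.+1.
Proof. by move=> /Ac h; apply: le_trans h; rewrite addr_ge0 // cabs_ge0. Qed.

Let c_le k N : (j0 <= k)%N -> (k <= N)%N -> c N <= c k.
Proof.
move=> jk /subnK <-; elim: (N - k)%N => // d; apply: le_trans.
by rewrite addSn -subr_ge0 c_ni // (leq_trans jk) // leq_addl.
Qed.

Let c_ge0 k : (j0 <= k)%N -> 0 <= c k.
Proof.
move=> jk; rewrite -(cvg_lim (@Rhausdorff R) c0); apply: limr_le.
  by apply/cvg_ex; exists 0.
by near=> N; apply: c_le => //; near: N; exact: nbhs_infty_ge.
Unshelve. all: by end_near. Qed.

(* The sum of the two entries of the first row changes by at most [2 * (c k - c k.+1)] per step,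
   which telescopes. *)
Lemma companion_bound k N : (j0 <= k)%N -> c k <= 1 / 4 -> (k <= N)%N ->
  [/\ cabs (P k N 0 0 + P k N 0 1 - 1) <= 2 * (c k - c N),
      cabs (P k N 0 1) <= 2 * c k & cabs (P k N 0 0) <= 2].
Proof.
move=> jk ck /subnK <-; elim: (N - k)%N => [|d].
  rewrite add0n Pk !mxE /= addr0 !subrr cabs0 mulr0 cabs1; split => //.
    by rewrite mulr_ge0 // c_ge0.
  by rewrite ler1n.
rewrite addSn; set M := (d + k)%N.
have kM : (k <= M)%N by rewrite leq_addl.
have jM : (j0 <= M)%N by apply: leq_trans kM.
move=> [h1 h2 h3]; rewrite PS0 // PS1 //.
set u := P k M 0 0 in h1 h2 h3 *; set v := P k M 0 1 in h1 h2 h3 *.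
have hA := Ac jM; have hM := c_le jk kM; have hM1 : 0 <= c M.+1 by rewrite c_ge0 // leqW.
have a0 := cabs_ge0 (A M 0 0 - 1); have a1 := cabs_ge0 (A M 0 1).
have u0 := cabs_ge0 u; set w := u * A M 0 1.
have hw : cabs w <= 2 * (c M - c M.+1) by rewrite cabsM; nra.
have hs : cabs (u * A M 0 0 + v + w - 1) <= 2 * (c k - c M.+1).
  have -> : u * A M 0 0 + v + w - 1 = (u + v - 1) + (u * (A M 0 0 - 1) + w) by ring.
  apply: le_trans (cabsD _ _) _; have := cabsD (u * (A M 0 0 - 1)) w.
  rewrite !cabsM; nra.
split => //; first lra.
(* The modulus is at most 1 + 4 * c k, and the threshold 1 / 4 for [c k] is what brings this back to
   2 and closes the induction. *)
have -> : u * A M 0 0 + v = (u * A M 0 0 + v + w - 1) - w + 1 by ring.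
apply: le_trans (cabsD _ _) _; rewrite cabs1.
have := cabsB (u * A M 0 0 + v + w - 1) w; lra.
Qed.

(** The row sum [s] converges because its increments are dominated by a telescoping series, and the
    second entry tends to 0, so the first entry converges. The 4 is 2 from the row sum plus 2 from
    the second entry in [companion_bound]. *)
Lemma companion_cvg0 k : (j0 <= k)%N -> c k <= 1 / 4 ->
  exists2 a : C, P k N 0 0 @[N --> \oo] --> a & cabs (a - 1) <= 4 * c k.
Proof.
move=> jk ck.
pose s d := P k (k + d)%N 0 0 + P k (k + d)%N 0 1.
have ss d : cabs (s d.+1 - s d) <= 2 * c (k + d)%N - 2 * c (k + d).+1%N.
  have kd : (k <= k + d)%N by rewrite leq_addr.
  have [_ _ h3] := companion_bound jk ck kd.
  have hA := Ac (leq_trans jk kd).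
  have -> : s d.+1 - s d = P k (k + d)%N 0 0 * ((A (k + d)%N 0 0 - 1) + A (k + d)%N 0 1).
    by rewrite /s addnS PS0 // PS1 //; ring.
  rewrite cabsM.
  have := cabsD (A (k + d)%N 0 0 - 1) (A (k + d)%N 0 1).
  have := cabs_ge0 (A (k + d)%N 0 0 - 1); have := cabs_ge0 (A (k + d)%N 0 1).
  have := cabs_ge0 (P k (k + d)%N 0 0).
  have := cabs_ge0 (A (k + d)%N 0 0 - 1 + A (k + d)%N 0 1).
  nra.
have cv d : cabs (P k (k + d).+1 0 1) <= 2 * (c (k + d)%N - c (k + d).+1).
  have kd : (k <= k + d)%N by rewrite leq_addr.
  have [_ _ h3] := companion_bound jk ck kd.
  have hA := Ac (leq_trans jk kd).
  rewrite PS1 // cabsM; have := cabs_ge0 (A (k + d)%N 0 0 - 1).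
  have := cabs_ge0 (A (k + d)%N 0 1); have := cabs_ge0 (P k (k + d)%N 0 0); nra.
have ck0 : c (k + d)%N @[d --> \oo] --> (0 : R).
  exact: (cvg_comp _ _ (@cvg_addnl k) c0).
have ck1 : c (k + d).+1 @[d --> \oo] --> (0 : R).
  exact: (cvg_comp _ _ (@cvg_addnl k.+1) c0).
have v0 : P k (k + d).+1 0 1 @[d --> \oo] --> (0 : C).
  apply: cvg_cabs.
  have c2 : 2 * (c (k + d)%N - c (k + d).+1) @[d --> \oo] --> (0 : R).
    by have := cvgM (cvg_cst (2 : R)) (cvgB ck0 ck1); rewrite subrr mulr0 => h; exact: h.
  apply: squeeze_cvgr (cvg_cst (0 : R)) c2.
  by near=> d; rewrite subr0 cabs_ge0 cv.
have /cvg_ex[S0 cS0] : cvgn (series (fun d => s d.+1 - s d)).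
  apply: (@cvg_normed_series R _ _ ss); apply/cvg_ex; exists (2 * c k - 2 * 0).
  have E : series (fun d => 2 * c (k + d)%N - 2 * c (k + d).+1) = (fun d => 2 * c k - 2 * c (k +
    d)%N).
    apply/funext => d; rewrite /series /=.
    rewrite (eq_bigr (fun i => - (2 * c (k + i.+1)%N - 2 * c (k + i)%N))); last by move=> i _;
      rewrite opprB addnS.
    by rewrite sumrN telescope_sumr // addn0 opprB.
  by rewrite E; have h := cvgB (cvg_cst (2 * c k : R)) (cvgM (cvg_cst (2 : R)) ck0); exact: h.
have cs : s d @[d --> \oo] --> S0 + s 0%N.
  have E : s = (fun d => series (fun d => s d.+1 - s d) d + s 0%N).
    by apply/funext => d; rewrite /series /= telescope_sumr // subrK.
  by rewrite {1}E; exact: (cvgD cS0 (cvg_cst (s 0%N))).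
have cs1 : s d.+1 @[d --> \oo] --> S0 + s 0%N by exact: (cvg_comp _ _ (@cvg_addnl 1) cs).
have cP : P k (k + d).+1 0 0 @[d --> \oo] --> S0 + s 0%N.
  have E : (fun d => P k (k + d).+1 0 0) = (fun d => s d.+1 - P k (k + d).+1 0 1).
    by apply/funext => d; rewrite /s addnS addrK.
  by rewrite E -[X in _ --> X]subr0; exact: (cvgB cs1 v0).
exists (S0 + s 0%N).
  rewrite -(cvg_shiftn k.+1 (fun N => P k N 0 0)).
  by apply: cvg_trans cP; apply: near_eq_cvg; near=> d; rewrite /= addnS addnC.
have cP1 : P k (k + d).+1 0 0 - 1 @[d --> \oo] --> (S0 + s 0%N - 1 : C).
  by have h := cvgB cP (cvg_cst (1 : C)); exact: h.
have cabsP := cvg_comp _ _ cP1 (@continuous_cabs R (S0 + s 0%N - 1)).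
rewrite -(cvg_lim (@Rhausdorff R) cabsP); apply: limr_le.
  by apply/cvg_ex; exists (cabs (S0 + s 0%N - 1)).
near=> d => /=.
have kd : (k <= (k + d).+1)%N by rewrite leqW // leq_addr.
have [h1 h2 _] := companion_bound jk ck kd.
have := cabsB (P k (k + d).+1 0 0 + P k (k + d).+1 0 1 - 1) (P k (k + d).+1 0 1).
rewrite addrAC addrK.
have := c_ge0 (leq_trans jk kd); rewrite /= => h4 h5.
apply: (le_trans h5); lra.
Unshelve. all: by end_near. Qed.

(** Convergence holds for large [k] by smallness of the tail, and the recurrence [P00] carries it
    down to every [k], two larger indices at a time. *)
Lemma companion_cvg k : exists a : C, P k N 0 0 @[N --> \oo] --> a.
Proof.
have [k0 jk0 ck0] : exists2 k0, (j0 <= k0)%N & c k0 <= 1 / 4.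
  have /cvgr_lt/(_ (1 / 4)) : c j @[j --> \oo] --> (0 : R) by [].
  move=> /(_ _)[]; first by lra.
  move=> N _ hN; exists (maxn j0 N); first exact: leq_maxl.
  by apply: ltW; apply: hN => /=; exact: leq_maxr.
have big m : (k0 <= m)%N -> exists a : C, P m N 0 0 @[N --> \oo] --> a.
  move=> km; have [a ha _] := companion_cvg0 (leq_trans jk0 km) (le_trans (c_le jk0 km) ck0).
  by exists a.
suff H d m : (k0 <= m + d)%N -> exists a : C, P m N 0 0 @[N --> \oo] --> a.
  by apply: (H k0 k); rewrite leq_addl.
elim: d m => [m|d IH m h]; first by rewrite addn0; exact: big.
have [a1 h1] := IH m.+1 (ltac:(by rewrite addSnnS)).
have [a2 h2] := IH m.+2 (ltac:(by rewrite !addSn -addnS; apply: leq_trans h _; rewrite leqW)).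
exists (A m 0 0 * a1 + A m 0 1 * a2).
have h3 : A m 0 0 * P m.+1 N 0 0 + A m 0 1 * P m.+2 N 0 0 @[N --> \oo] --> A m 0 0 * a1 + A m 0 1
  * a2.
  by have h3 := cvgD (cvgM (cvg_cst (A m 0 0)) h1) (cvgM (cvg_cst (A m 0 1)) h2); exact: h3.
apply: cvg_trans h3; apply: near_eq_cvg; near=> N.
by rewrite (P00 (m := m)) //; near: N; exact: nbhs_infty_gt.
Unshelve. all: by end_near. Qed.

(** Appending a factor sends the second column to a multiple, tending to 0, of the first; prepending
    one shifts the first row of the next product into the second row. Hence the limit has rows
    (alpha k, 0) and (alpha (k+1), 0), and peeling off the first factor gives the recurrence. *)
Theorem companion_product : exists alpha : nat -> C,
  [/\ alpha k @[k --> \oo] --> (1 : C),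
      forall k, alpha k = A k 0 0 * alpha k.+1 + A k 0 1 * alpha k.+2,
      forall k, mxprod_from A k 0 0 = alpha k &
      forall k, mxprod_from A k 1 0 = alpha k.+1].
Proof.
pose alpha k : C := lim (P k N 0 0 @[N --> \oo]).
have calpha k : P k N 0 0 @[N --> \oo] --> alpha k.
  by have [a ha] := companion_cvg k; apply/cvgP: ha.
have P10 k : P k N 1 0 @[N --> \oo] --> alpha k.+1.
  apply: cvg_trans (calpha k.+1); apply: near_eq_cvg; near=> N.
  by rewrite PS10 //; near: N; exact: nbhs_infty_gt.
have cA1 : A N 0 1 @[N --> \oo] --> (0 : C).
  apply: cvg_cabs.
  have c2 : c N - c N.+1 @[N --> \oo] --> (0 : R).
    by have := cvgB c0 (cvg_comp _ _ (@cvg_addnl 1) c0); rewrite subrr => h; exact: h.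
  apply: squeeze_cvgr (cvg_cst (0 : R)) c2.
  near=> N; rewrite subr0 cabs_ge0 /=.
  have jN : (j0 <= N)%N by near: N; exact: nbhs_infty_ge.
  have := Ac jN; have := cabs_ge0 (A N 0 0 - 1); lra.
have P01 k : P k N 0 1 @[N --> \oo] --> (0 : C).
  rewrite -cvg_shiftS.
  have h : P k N 0 0 * A N 0 1 @[N --> \oo] --> (0 : C).
    by have h := cvgM (calpha k) cA1; rewrite mulr0 in h; exact: h.
  apply: cvg_trans h; apply: near_eq_cvg; near=> N.
  by rewrite /= PS1 //; near: N; exact: nbhs_infty_ge.
have P11 k : P k N 1 1 @[N --> \oo] --> (0 : C).
  apply: cvg_trans (P01 k.+1); apply: near_eq_cvg; near=> N.
  by rewrite PS10 //; near: N; exact: nbhs_infty_gt.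
have lP k : mxprod_from A k = mx2 (alpha k) 0 (alpha k.+1) 0.
  apply: cvg_lim => //; apply: cvg_mx => i j.
  have i2 (x : 'I_2) : x = 0 \/ x = 1 by case: x => [[|[|]]] // ?; [left|right]; apply/val_inj.
  case: (i2 i) => ->; case: (i2 j) => ->; rewrite [X in _ --> X]mxE /=.
  - exact: (calpha k).
  - exact: (P01 k).
  - exact: (P10 k).
  - exact: (P11 k).
exists alpha; split; last 2 first.
- by move=> k; rewrite lP mxE.
- by move=> k; rewrite lP mxE.
- apply: cvg_cabs.
  have c4 : 4 * c N @[N --> \oo] --> (0 : R).
    by have h := cvgM (cvg_cst (4 : R)) c0; rewrite mulr0 in h; exact: h.
  apply: squeeze_cvgr (cvg_cst (0 : R)) c4.
  near=> k; rewrite cabs_ge0 /=.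
  have jk : (j0 <= k)%N by near: k; exact: nbhs_infty_ge.
  have ck : c k <= 1 / 4.
    near: k; have /cvgr_le := c0; apply; lra.
  have [a ha] := companion_cvg0 jk ck.
  by have -> : a = alpha k by exact: (cvg_unique (@norm_hausdorff _ _) ha (calpha k)).
- move=> k; apply: (cvg_unique (@norm_hausdorff _ _) (calpha k)).
  have h3 : A k 0 0 * P k.+1 N 0 0 + A k 0 1 * P k.+2 N 0 0 @[N --> \oo] -->
      A k 0 0 * alpha k.+1 + A k 0 1 * alpha k.+2.
    by have h3 := cvgD (cvgM (cvg_cst (A k 0 0)) (calpha k.+1)) (cvgM (cvg_cst (A k 0 1)) (calpha
      k.+2)); exact: h3.
  apply: cvg_trans h3; apply: near_eq_cvg; near=> N.
  by rewrite (P00 (m := k)) //; near: N; exact: nbhs_infty_gt.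
Unshelve. all: by end_near. Qed.
End companion_products.

(** * Recessive solutions of three-term recurrences *)

Section asymptotics.
Variable R : realType.
Local Notation C := (Cplx R).
Implicit Types (w s : C) (j k : nat).

(** The denominator j + 2 is chosen so that the product of two such bounds, 4 / (j+2)^2, lies below
    the telescoping quantity 4 / ((j+1)(j+2)). *)
Lemma cabs_inv_shift w : \forall j \near \oo, cabs ((j%:R + w)^-1) <= 2 / (j%:R + 2).
Proof.
near=> j.
have jw : 2 * cabs w + 2 <= j%:R by near: j; exact: nbhs_infty_ger.
have w0 := cabs_ge0 w; have j0 : 0 <= j%:R :> R by rewrite ler0n.
have jw1 : (j%:R + 2) / 2 <= cabs (j%:R + w).
  have := cabsB (j%:R + w) w; rewrite addrK cabs_nat; lra.
by rewrite cabsV -[leRHS]invf_div lef_pV2 ?posrE //; lra.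
Unshelve. all: by end_near. Qed.

Lemma cvg_inv_shift w : (j%:R + w)^-1 @[j --> \oo] --> (0 : C).
Proof.
apply: cvg_cabs.
have h0 : 2 * (j.+1%:R)^-1 @[j --> \oo] --> (0 : R).
  by have h := cvgM (cvg_cst (2 : R)) (@cvg_harmonic R); rewrite mulr0 in h; exact: h.
apply: squeeze_cvgr (cvg_cst (0 : R)) h0.
near=> j; rewrite subr0 cabs_ge0 /=.
have h : cabs ((j%:R + w)^-1) <= 2 / (j%:R + 2) by near: j; exact: cabs_inv_shift.
apply: le_trans h _; rewrite ler_pM2l // lef_pV2 ?posrE ?ltr0n // -?natrD ?ltr0n ?addn2 //.
by rewrite ler_nat.
Unshelve. all: by end_near. Qed.

Lemma companion_quadratic (A : nat -> 'M[C]_2) s w1 w2 (t : nat -> C) (K : R) :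
  (forall j, A j 1 0 = 1) -> (forall j, A j 1 1 = 0) ->
  (forall j, A j 0 0 = 1 + s / ((j%:R + w1) * (j%:R + w2))) ->
  (forall j, A j 0 1 = t j / ((j%:R + w1) * (j%:R + w2))) ->
  (\forall j \near \oo, cabs (t j) <= K) ->
  exists alpha : nat -> C,
  [/\ alpha k @[k --> \oo] --> (1 : C),
      forall k, alpha k = A k 0 0 * alpha k.+1 + A k 0 1 * alpha k.+2,
      forall k, mxprod_from A k 0 0 = alpha k &
      forall k, mxprod_from A k 1 0 = alpha k.+1].
Proof.
move=> A10 A11 A00 A01 tK.
(* Then c j - c (j+1) = 4 (|s| + K) / ((j+1)(j+2)), which dominates |s| + K times the two bounds 2 /
   (j+2) on the inverse linear factors. *)
pose c j : R := 4 * (cabs s + K) * (j.+1%:R)^-1.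
have c0 : c j @[j --> \oo] --> (0 : R).
  by have h := cvgM (cvg_cst (4 * (cabs s + K) : R)) (@cvg_harmonic R); rewrite mulr0 in h;
    exact: h.
have : \forall j \near \oo, cabs (A j 0 0 - 1) + cabs (A j 0 1) <= c j - c j.+1.
  near=> j.
  have h1 : cabs ((j%:R + w1)^-1) <= 2 / (j%:R + 2) by near: j; exact: cabs_inv_shift.
  have h2 : cabs ((j%:R + w2)^-1) <= 2 / (j%:R + 2) by near: j; exact: cabs_inv_shift.
  have ht : cabs (t j) <= K by near: j; exact: tK.
  rewrite A00 A01 [1 + _]addrC addrK !cabsM invfM cabsM.
  set u := cabs _ in h1 *; set v := cabs _ in h2 *.
  have j0 : 0 <= j%:R :> R by rewrite ler0n.
  have j2 : 0 < (j%:R + 2)^-1 :> R by rewrite invr_gt0; lra.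
  have uv : u * v <= 4 * ((j%:R + 2)^-1 * (j%:R + 2)^-1).
    rewrite (_ : 4 * _ = (2 / (j%:R + 2)) * (2 / (j%:R + 2))); last by ring.
    by rewrite ler_pM // cabs_ge0.
  have -> : c j - c j.+1 = (cabs s + K) * (4 * ((j%:R + 1)^-1 * (j%:R + 2)^-1)).
    rewrite /c -!natr1; field; apply/andP; split; lra.
  rewrite -mulrDl ler_pM // ?mulr_ge0 ?cabs_ge0 ?addr_ge0 ?cabs_ge0 ?lerD //.
  apply: le_trans uv _; rewrite ler_pM2l // ler_pM2r // lef_pV2 ?posrE; lra.
case=> j0 _ Ac.
by apply: (@companion_product _ A c j0).
Unshelve. all: by end_near. Qed.

(** Once |rho j| <= 1/r the quantities |q j| r^j stop growing, so the sum of the finitely many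
    earlier ones bounds them all. *)
Lemma ratio_decay (q rho : nat -> C) (r : R) : 0 < r ->
  (forall j, q j.+1 = rho j * q j) -> rho j @[j --> \oo] --> (0 : C) ->
  exists B, forall j, cabs (q j) * r ^+ j <= B.
Proof.
move=> r0 qS rho0.
have [N _ hN] : \forall j \near \oo, cabs (rho j) <= r^-1.
  have h := cvg_comp _ _ rho0 (@continuous_cabs R 0); rewrite cabs0 in h.
  by move/cvgr_le: h; apply; rewrite invr_gt0.
pose T j := cabs (q j) * r ^+ j.
have T0 j : 0 <= T j by rewrite mulr_ge0 ?cabs_ge0 // exprn_ge0 // ltW.
exists (\sum_(i < N.+1) T i) => j; rewrite -/(T j).
have [jN|/ltnW Nj] := leqP j N.
  by rewrite (bigD1 (Ordinal (jN : j < N.+1)%N)) //= lerDl sumr_ge0.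
have TN : T j <= T N.
  rewrite -(subnK Nj); elim: (j - N)%N => // d; apply: le_trans.
  rewrite addSn /T qS cabsM exprS mulrACA; apply: ler_piMl; first exact: T0.
  by rewrite -ler_pdivlMr // mul1r hN //= leq_addl.
apply: le_trans TN _.
by rewrite (bigD1 (@ord_max N)) //= lerDl sumr_ge0.
Qed.

Lemma ratio_cvg0 (q rho : nat -> C) :
  (forall j, q j.+1 = rho j * q j) -> rho j @[j --> \oo] --> (0 : C) ->
  q j @[j --> \oo] --> (0 : C).
Proof.
move=> qS rho0; have [|B hB] := @ratio_decay q rho 2 _ qS rho0; first by lra.
apply: cvg_cabs.
have h0 : B * (1 / 2) ^+ j @[j --> \oo] --> (0 : R).
  have h12 : `|1 / 2 : R| < 1 by rewrite ger0_norm; lra.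
  by have h := cvgM (cvg_cst B) (cvg_expr h12); rewrite mulr0 in h; exact: h.
apply: squeeze_cvgr (cvg_cst (0 : R)) h0.
near=> j; rewrite subr0 cabs_ge0 /= expr_div_n expr1n mul1r ler_pdivlMr ?exprn_gt0 //.
Unshelve. all: by end_near. Qed.

(* The Casoratian [W] of two solutions satisfies [W_(j+1) = - W_j / y_j] and so grows faster than
   any admissible [be]. *)
Lemma casoratian_eq0 (al be a y bd g sigma : nat -> C) (B : R) :
  (forall j, al j = a j * al j.+1 + y j * al j.+2) ->
  (forall j, be j = a j * be j.+1 + y j * be j.+2) ->
  (forall j, y j != 0) -> al j @[j --> \oo] --> (1 : C) ->
  (forall j, be j = bd j * g j) -> (forall j, cabs (bd j) <= B) ->
  (forall j, g j.+1 = sigma j * g j) ->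
  sigma j * y j @[j --> \oo] --> (0 : C) ->
  sigma j.+1 * y j @[j --> \oo] --> (0 : C) ->
  al 0%N * be 1%N = al 1%N * be 0%N.
Proof.
move=> alS beS y0 al1 beg bdB gS sy sy1; apply/eqP; rewrite -subr_eq0; apply/negPn/negP => W0.
pose W j := al j * be j.+1 - al j.+1 * be j.
have WS j : W j.+1 = - (y j)^-1 * W j.
  apply: (mulfI (y0 j)); rewrite mulrA mulrN mulfV // mulN1r /W (alS j) (beS j); ring.
have Wn0 j : W j != 0.
  by elim: j => // j; rewrite WS mulf_eq0 oppr_eq0 invr_eq0 (negPf (y0 j)).
(* Dividing the definition of [W j] by [W j] expresses 1 through [q] and [q1] with bounded
   coefficients. The ratios of [q] and [q1] are -(sigma j * y j) and -(sigma (j+1) * y j), so the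
   two limit hypotheses force both to 0, a contradiction. *)
pose q j := g j / W j; pose q1 j := sigma j * q j.
have qS j : q j.+1 = - (sigma j * y j) * q j.
  rewrite /q gS WS; field; rewrite Wn0 y0 //.
have q1S j : q1 j.+1 = - (sigma j.+1 * y j) * q1 j by rewrite /q1 qS; ring.
have cN (u : nat -> C) : u j @[j --> \oo] --> (0 : C) -> - u j @[j --> \oo] --> (0 : C).
  by move=> h; have := cvgN h; rewrite oppr0 => h'; exact: h'.
have cq := ratio_cvg0 qS (cN _ sy); have cq1 := ratio_cvg0 q1S (cN _ sy1).
have E j : 1 = al j * bd j.+1 * q1 j - al j.+1 * bd j * q j.
  by rewrite -(divff (Wn0 j)) {1}/W /q1 /q !beg gS; ring.
have al2 : \forall j \near \oo, cabs (al j) <= 2.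
  have h := cvg_comp _ _ al1 (@continuous_cabs R 1); rewrite cabs1 in h.
  by move/cvgr_le: h; apply; lra.
have al2S : \forall j \near \oo, cabs (al j.+1) <= 2.
  by have := @cvg_addnl 1 _ al2.
(* With |al| <= 2 and |bd| <= |B|, the right-hand side of [E] is at most 4 |B| times this constant,
   hence less than 1. *)
have small (u : nat -> C) : u j @[j --> \oo] --> (0 : C) ->
    \forall j \near \oo, cabs (u j) <= (4 * (1 + `|B|) + 1)^-1.
  move=> h; have h' := cvg_comp _ _ h (@continuous_cabs R 0); rewrite cabs0 in h'.
  by move/cvgr_le: h'; apply; rewrite invr_gt0; have := normr_ge0 B; lra.
have [j [a1 a2 a3 a4]] : exists j, [/\ cabs (al j) <= 2, cabs (al j.+1) <= 2,
    cabs (q j) <= (4 * (1 + `|B|) + 1)^-1 & cabs (q1 j) <= (4 * (1 + `|B|) + 1)^-1].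
  have : \forall j \near \oo, [/\ cabs (al j) <= 2, cabs (al j.+1) <= 2,
    cabs (q j) <= (4 * (1 + `|B|) + 1)^-1 & cabs (q1 j) <= (4 * (1 + `|B|) + 1)^-1].
    near=> j; split; near: j; [exact: al2|exact: al2S|exact: small|exact: small].
  by case=> N _ /(_ N (leqnn N)) h; exists N.
have := cabsB (al j * bd j.+1 * q1 j) (al j.+1 * bd j * q j).
rewrite -E cabs1 (cabsM _ (q1 j)) (cabsM _ (q j)) (cabsM (al j)) (cabsM (al j.+1)).
set e := (_ + 1)^-1 in a3 a4; have B0 := normr_ge0 B.
have e0 : 0 < e by rewrite invr_gt0; lra.
have ee : e * (4 * (1 + `|B|) + 1) = 1 by rewrite mulVf // gt_eqF //; lra.
have b1 := le_trans (bdB j) (ler_norm B); have b2 := le_trans (bdB j.+1) (ler_norm B).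
have p1 : cabs (al j) * cabs (bd j.+1) * cabs (q1 j) <= 2 * `|B| * e.
  by rewrite ler_pM ?mulr_ge0 ?cabs_ge0 // ler_pM ?cabs_ge0.
have p2 : cabs (al j.+1) * cabs (bd j) * cabs (q j) <= 2 * `|B| * e.
  by rewrite ler_pM ?mulr_ge0 ?cabs_ge0 // ler_pM ?cabs_ge0.
move: p1 p2; set P1 := _ * cabs (q1 j); set P2 := _ * cabs (q j).
move: {a3 a4} ee e0; move: e P1 P2 (`|B|) => e P1 P2 b ee e0 p1 p2 p3.
have h : 1 = 4 * (b * e) + 5 * e by rewrite -[LHS]ee; ring.
rewrite -mulrA in p1; rewrite -mulrA in p2.
move: (b * e) h p1 p2 => f h p1 p2; lra.
Unshelve. all: by end_near. Qed.

End asymptotics.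

(** * Entire power series *)

Section power_series.
Variable R : realType.
Local Notation C := (Cplx R).
Implicit Types (a c u : nat -> C) (z w : C).

Let cvg_half (M : R) : series (fun k => M * (1 / 2) ^+ k) @ \oo --> 2 * M.
Proof.
have h12 : `|1 / 2 : R| < 1 by rewrite ger0_norm; lra.
have h := cvg_geometric_series (a := M) h12.
by have -> : 2 * M = M * (1 - 1 / 2)^-1 by field.
Qed.

Lemma geometric_cvg u (M : R) : (forall k, cabs (u k) <= M * (1 / 2) ^+ k) ->
  cvgn (series u).
Proof. by move=> uM; apply: cvg_normed_series uM _; apply/cvg_ex; exists (2 * M). Qed.

Lemma geometric_bound u (M : R) : (forall k, cabs (u k) <= M * (1 / 2) ^+ k) ->
  cabs (lim (series u @ \oo)) <= 2 * M.
Proof.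
move=> uM; have cu := geometric_cvg uM.
have uMn n : cabs (series u n) <= series (fun k => M * (1 / 2) ^+ k) n.
  rewrite /series /=; elim: n => [|n IH]; first by rewrite !big_geq // cabs0.
  by rewrite !big_nat_recr //= (le_trans (cabsD _ _)) // lerD.
have ccu := cvg_comp _ _ cu (@continuous_cabs R _).
rewrite -(cvg_lim (@Rhausdorff R) ccu) -(cvg_lim (@Rhausdorff R) (@cvg_half M)).
apply: ler_lim; [by apply/cvg_ex; eexists; exact: ccu|by apply/cvg_ex; eexists; exact: (@cvg_half
  M)|].
by near=> n; exact: uMn.
Unshelve. all: by end_near. Qed.

(** An infinite radius of convergence, phrased as a bound at every radius: losing a factor 2^k only
    costs passing from r to 2r. Comparison with (1/2)^k and multiplication by the index both rest on
    this. *)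
Definition entire_coef a := forall r : R, 0 < r -> exists B, forall k, cabs (a k) * r ^+ k <= B.

Lemma entire_geometric a (rho : R) : entire_coef a -> 0 < rho ->
  exists M, forall k, cabs (a k) * rho ^+ k <= M * (1 / 2) ^+ k.
Proof.
move=> ea rho0; have [|B hB] := ea (2 * rho); first by rewrite mulr_gt0.
exists B => k; rewrite expr_div_n expr1n mul1r ler_pdivlMr ?exprn_gt0 // -mulrA -exprMn [rho *
  2]mulrC.
exact: hB.
Qed.

Definition psum a z : C := lim (series (fun k => a k * z ^+ k) @ \oo).

Let term_geometric a z : entire_coef a -> exists M, forall k, cabs (a k * z ^+ k) <= M * (1 / 2)
  ^+ k.
Proof.
move=> ea; have [|M hM] := @entire_geometric a (cabs z + 1) ea; first by rewrite ltr_wpDl ?cabs_ge0.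
exists M => k; apply: le_trans (hM k); rewrite cabsM cabsX ler_wpM2l ?cabs_ge0 //.
by rewrite lerXn2r ?nnegrE ?addr_ge0 ?cabs_ge0 // lerDl.
Qed.

Lemma psum_cvg a z : entire_coef a -> series (fun k => a k * z ^+ k) @ \oo --> psum a z.
Proof. by move=> /(@term_geometric a z)[M hM]; have := geometric_cvg hM. Qed.

Lemma psum_unique a z (l : C) : series (fun k => a k * z ^+ k) @ \oo --> l -> psum a z = l.
Proof. by move=> h; apply: cvg_lim h. Qed.

Lemma entire_coefD a c : entire_coef a -> entire_coef c -> entire_coef (fun k => a k + c k).
Proof.
move=> ea ec r r0; have [B hB] := ea r r0; have [D hD] := ec r r0.
exists (B + D) => k; apply: le_trans (lerD (hB k) (hD k)).
by rewrite -mulrDl ler_wpM2r ?cabsD // exprn_ge0 // ltW.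
Qed.

Lemma entire_coefZ (s : C) a : entire_coef a -> entire_coef (fun k => s * a k).
Proof.
move=> ea r r0; have [B hB] := ea r r0.
by exists (cabs s * B) => k; rewrite cabsM -mulrA ler_wpM2l ?cabs_ge0.
Qed.

Lemma entire_coefM a (t : nat -> C) (K : R) : (forall k, cabs (t k) <= K * 2 ^+ k) ->
  entire_coef a -> entire_coef (fun k => t k * a k).
Proof.
move=> tK ea r r0; have [|B hB] := ea (2 * r); first by rewrite mulr_gt0.
have K0 : 0 <= K by have := le_trans (cabs_ge0 _) (tK 0%N); rewrite expr0 mulr1.
exists (K * B) => k; rewrite cabsM.
apply: le_trans (ler_wpM2l K0 (hB k)); rewrite exprMn.
rewrite (_ : K * _ = K * 2 ^+ k * (cabs (a k) * r ^+ k)); last by ring.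
by rewrite -mulrA ler_wpM2r // mulr_ge0 ?cabs_ge0 // exprn_ge0 // ltW.
Qed.

Lemma entire_coefS a : entire_coef a -> entire_coef (fun k => a k.+1).
Proof.
move=> ea r r0; have [B hB] := ea r r0.
exists (B / r) => k; rewrite ler_pdivlMr // -mulrA -exprSr; exact: hB.
Qed.

Lemma entire_coef_cons a : entire_coef (fun k => a k.+1) -> entire_coef a.
Proof.
move=> ea r r0; have [B hB] := ea r r0.
exists (Num.max (cabs (a 0%N)) (B * r)) => -[|k].
  by rewrite expr0 mulr1 le_max lexx.
by rewrite le_max exprSr mulrA ler_pM2r // hB orbT.
Qed.

Lemma psumD a c z : entire_coef a -> entire_coef c ->
  psum (fun k => a k + c k) z = psum a z + psum c z.
Proof.
move=> ea ec; apply: psum_unique.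
have h := cvgD (@psum_cvg _ z ea) (@psum_cvg _ z ec).
have -> : series (fun k => (a k + c k) * z ^+ k) =
  (fun n => series (fun k => a k * z ^+ k) n + series (fun k => c k * z ^+ k) n).
  apply/funext => n; rewrite /series /= -big_split /=.
  by apply: eq_bigr => i _; rewrite mulrDl.
exact: h.
Qed.

Lemma psumZ (s : C) a z : entire_coef a -> psum (fun k => s * a k) z = s * psum a z.
Proof.
move=> ea; apply: psum_unique.
have h := cvgM (cvg_cst s) (@psum_cvg _ z ea).
have -> : series (fun k => s * a k * z ^+ k) = (fun n => s * series (fun k => a k * z ^+ k) n).
  apply/funext => n; rewrite /series /= mulr_sumr.
  by apply: eq_bigr => i _; rewrite mulrA.
exact: h.
Qed.

Lemma psum_recl a z : entire_coef a -> psum a z = a 0%N + z * psum (fun k => a k.+1) z.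
Proof.
move=> ea; apply: psum_unique.
have h := cvgD (cvg_cst (a 0%N)) (cvgM (cvg_cst z) (@psum_cvg _ z (entire_coefS ea))).
rewrite -cvg_shiftS.
have -> : [sequence series (fun k => a k * z ^+ k) n.+1]_n =
    (fun n => a 0%N + z * series (fun k => a k.+1 * z ^+ k) n).
  apply/funext => n; rewrite /series /= big_nat_recl // expr0 mulr1; congr (_ + _).
  by rewrite mulr_sumr; apply: eq_bigr => i _; rewrite exprS mulrCA.
exact: h.
Qed.

(** Multiplying the remainder by z + h produces the next one up to the extra term (k+1) z^k h^2.
    With k + 1 <= 2^(k+1) each of the two pieces takes half of the new bound. *)
Let taylor2 (rho : R) z h k : cabs z + 1 <= rho -> cabs h <= 1 ->
  cabs ((z + h) ^+ k.+1 - z ^+ k.+1 - k.+1%:R * z ^+ k * h) <= (2 * rho) ^+ k.+1 * cabs h ^+ 2.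
Proof.
move=> hz h1; have z0 := cabs_ge0 z.
have rho1 : 1 <= rho by lra.
have wr : cabs (z + h) <= rho by have := cabsD z h; lra.
have h20 : 0 <= cabs h ^+ 2 by rewrite exprn_ge0 ?cabs_ge0.
elim: k => [|k IH].
  rewrite !expr1 expr0 mulr1 mul1r (_ : z + h - z - h = 0); last by ring.
  by rewrite cabs0 mulr_ge0 // mulr_ge0 //; lra.
rewrite (_ : _ - _ = (z + h) * ((z + h) ^+ k.+1 - z ^+ k.+1 - k.+1%:R * z ^+ k * h) +
   k.+1%:R * z ^+ k * h ^+ 2); last by rewrite -[in LHS]natr1 !exprS; ring.
apply: le_trans (cabsD _ _) _; rewrite !cabsM !cabsX cabs_nat.
have zr : cabs z ^+ k <= rho ^+ k by rewrite lerXn2r ?nnegrE //; lra.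
have r1 : rho ^+ k <= rho ^+ k.+2 by rewrite ler_weXn2l // -addn2 leq_addr.
have k2 : k.+1%:R <= 2 ^+ k.+1 :> R.
  by rewrite -natrX ler_nat; apply: ltnW; exact: ltn_expl.
have e1 : cabs (z + h) * cabs ((z + h) ^+ k.+1 - z ^+ k.+1 - k.+1%:R * z ^+ k * h) <=
    rho * ((2 * rho) ^+ k.+1 * cabs h ^+ 2).
  by rewrite ler_pM ?cabs_ge0.
have e2 : k.+1%:R * cabs z ^+ k * cabs h ^+ 2 <= 2 ^+ k.+1 * rho ^+ k.+2 * cabs h ^+ 2.
  rewrite ler_wpM2r // ler_pM ?exprn_ge0 //; exact: le_trans zr r1.
apply: le_trans (lerD e1 e2) _.
rewrite le_eqVlt; apply/orP; left; apply/eqP; rewrite !exprMn ![_ ^+ k.+2]exprS; ring.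
Qed.

Lemma entire_coef_diff a : entire_coef a -> entire_coef (fun k => k.+1%:R * a k.+1).
Proof.
move=> ea; apply: (@entire_coefM _ (fun k => k.+1%:R) 2 _ (entire_coefS ea)) => k.
by rewrite cabs_nat -exprS -natrX ler_nat ltnW // ltn_expl.
Qed.

(** Summing the second-order remainders of the powers bounds the remainder of the series by K |h|^2
    for |h| <= 1, so no theorem on termwise differentiation is involved. *)
Lemma is_derive_psum a z : entire_coef a ->
  is_derive z 1 (psum a) (psum (fun k => k.+1%:R * a k.+1) z).
Proof.
move=> ea; have ed := entire_coef_diff ea; set d := psum _ z.
pose rho := cabs z + 1.
have rho0 : 0 < rho by rewrite ltr_wpDl ?cabs_ge0.
have [|M hM] := @entire_geometric _ (2 * rho) (entire_coefS ea); first by rewrite mulr_gt0.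
pose K := 2 * (M * (2 * rho)).
have est h : cabs h <= 1 -> cabs (psum a (z + h) - psum a z - d * h) <= K * cabs h ^+ 2.
  move=> h1.
  pose u k := a k.+1 * ((z + h) ^+ k.+1 - z ^+ k.+1 - k.+1%:R * z ^+ k * h).
  have hu k : cabs (u k) <= (M * (2 * rho) * cabs h ^+ 2) * (1 / 2) ^+ k.
    rewrite cabsM; apply: le_trans (ler_wpM2l (cabs_ge0 _) (@taylor2 rho z h k (lexx _) h1)) _.
    rewrite (_ : cabs (a k.+1) * ((2 * rho) ^+ k.+1 * cabs h ^+ 2) = cabs (a k.+1) * (2 * rho) ^+
      k * (2 * rho * cabs h ^+ 2)); last first.
      by rewrite exprSr; ring.
    rewrite (_ : M * (2 * rho) * cabs h ^+ 2 * (1 / 2) ^+ k = M * (1 / 2) ^+ k * (2 * rho * cabs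
      h ^+ 2)); last by ring.
    rewrite ler_wpM2r ?hM // mulr_ge0 ?exprn_ge0 ?cabs_ge0 // mulr_ge0 // ltW //.
  have -> : psum a (z + h) - psum a z - d * h = lim (series u @ \oo).
    apply/esym/cvg_lim => //.
    have sh w := cvg_comp _ _ (@cvg_addnl 1) (@psum_cvg _ w ea).
    have c1 := cvgB (cvgB (sh (z + h)) (sh z)) (cvgM (@psum_cvg _ z ed) (cvg_cst h)).
    have -> : series u = (fun n => series (fun k => a k * (z + h) ^+ k) (1 + n)%N -
        series (fun k => a k * z ^+ k) (1 + n)%N - series (fun k => k.+1%:R * a k.+1 * z ^+ k) n
          * h).
      apply/funext => n; rewrite /series /= !add1n !big_nat_recl // !expr0 opprD addrACA subrr
        add0r.
      rewrite mulr_suml -!sumrB; apply: eq_bigr => i _; rewrite /u; ring.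
    exact: c1.
  by apply: le_trans (geometric_bound hu) _; rewrite /K; lra.
apply: (@slope_is_derive _ _ (fun w => if w == z then d else (psum a w - psum a z) / (w - z))).
  near=> w; case: eqP => [->|/eqP]; first by rewrite !subrr mulr0.
  by rewrite -subr_eq0 => /divfK ->.
apply: (@cvg_cabs R C (nbhs z) (nbhs_filter z)).
have cz : K * cabs (w - z) @[w --> z] --> (0 : R).
  have cwz : w - z @[w --> z] --> (0 : C) by rewrite -(subrr z); exact: (cvgB cvg_id (cvg_cst z)).
  have h := cvgM (cvg_cst K) (cvg_comp _ _ cwz (@continuous_cabs R 0)).
  rewrite cabs0 mulr0 in h; exact: h.
have cz1 : \forall w \near z, cabs (w - z) <= 1.
  have cwz : w - z @[w --> z] --> (0 : C) by rewrite -(subrr z); exact: (cvgB cvg_id (cvg_cst z)).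
  have h := cvg_comp _ _ cwz (@continuous_cabs R 0); rewrite cabs0 in h.
  by move/cvgr_le: h; apply; lra.
suff H : \forall w \near z, 0 <= cabs ((if w == z then d else (psum a w - psum a z) / (w - z)) -
  d) <= K * cabs (w - z).
  exact: (squeeze_cvgr H (cvg_cst (0 : R)) cz).
near=> w; rewrite cabs_ge0 /=.
have K0 : 0 <= K.
  have := le_trans (cabs_ge0 _) (est 1 _); rewrite cabs1 expr1n mulr1; exact.
case: eqP => [->|/eqP wz]; first by rewrite !subrr cabs0 mulr0.
rewrite -subr_eq0 in wz.
have w1 : cabs (w - z) <= 1 by near: w; exact: cz1.
have := est _ w1; rewrite [z + _]addrC subrK => hw.
rewrite -(ler_pM2r (_ : 0 < cabs (w - z))) ?cabs_gt0 // -cabsM mulrBl divfK //.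
by rewrite -mulrA -expr2.
Unshelve. all: by end_near. Qed.

End power_series.

(** * Integrals over circles *)

Section circle_integral.
Variable R : realType.
Local Notation C := (Cplx R).
Local Notation mu := (@lebesgue_measure R).
Implicit Types (f F g : R -> R) (phi psi : C -> C).

Definition rint f : R := \int[mu]_(t in `[0%R, 2 * pi]) f t.

Let ab : 0 < 2 * pi :> R. Proof. by rewrite mulr_gt0 // pi_gt0. Qed.

Let integrable f : continuous f -> mu.-integrable `[0%R, 2 * pi] (EFin \o f).
Proof.
move=> cf; apply: continuous_compact_integrable; first exact: segment_compact.
exact: continuous_subspaceT.
Qed.

Lemma rintD f g : continuous f -> continuous g -> rint (fun t => f t + g t) = rint f + rint g.
Proof. by move=> cf cg; rewrite /rint RintegralD //; exact: integrable. Qed.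

Lemma rintZ (r : R) f : continuous f -> rint (fun t => r * f t) = r * rint f.
Proof. by move=> cf; rewrite /rint RintegralZl //; exact: integrable. Qed.

Lemma rint_cst (r : R) : rint (fun=> r) = r * (2 * pi).
Proof.
rewrite /rint Rintegral_cst //; congr (_ * _).
have h := @lebesgue_measure_itv R `[0, 2 * pi]%R; rewrite /= lte_fin ab sube0 in h.
exact: (congr1 fine h).
Qed.

Lemma rint_ge0 f : (forall t, 0 <= f t) -> 0 <= rint f.
Proof. by move=> f0; apply: Rintegral_ge0. Qed.

Lemma rint_derive F f : (forall t : R, is_derive t 1 F (f t)) -> continuous f ->
  rint f = F (2 * pi) - F 0.
Proof.
move=> dF cf; have cF : continuous F by move=> t; exact: is_derive_cvg (dF t).
rewrite /rint /Rintegral (@continuous_FTC2 _ f F 0 (2 * pi)) //.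
- exact: continuous_subspaceT.
- split.
  + by move=> t _; case: (dF t).
  + by apply: cvg_at_right_filter; exact: cF.
  + by apply: cvg_at_left_filter; exact: cF.
- by move=> t _; rewrite derive1E; case: (dF t).
Qed.

(* Only the values on the punctured plane matter: [star] stands for C^*. *)
Definition continuous_star phi := forall z : C, z != 0 -> phi w @[w --> z] --> phi z.

Definition circle (z0 : C) (t : R) : C := z0 * cexp (0 +i* t).

(** Integration is with respect to the angle: this is the contour integral of phi(z) dz / (iz) over
    the circle through [z0] centred at 0. *)
Definition cint (z0 : C) phi : C :=
  rint (fun t => complex.Re (phi (circle z0 t))) +i* rint (fun t => complex.Im (phi (circle z0 t))).

Lemma circle_neq0 z0 t : z0 != 0 -> circle z0 t != 0.
Proof. by move=> h; rewrite mulf_neq0 // cexp_neq0. Qed.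

Lemma circle_velocity z0 t : is_velocity t (circle z0) (circle z0 t * 'i%C).
Proof.
have it : is_velocity t (fun s : R => 0 +i* s : C) 'i%C.
  by split => /=; [exact: is_derive_cst|exact: is_derive_id].
have e := velocity_comp (is_derive_cexp (0 +i* t : C)) it.
have m : is_derive (cexp (0 +i* t : C)) 1 (fun w : C => z0 * w) z0.
  have := @is_deriveZ C C C id z0 (cexp (0 +i* t : C)) 1 1 (is_derive_id _ _).
  by rewrite [_ *: _]mulr1; exact.
have := velocity_comp m e; rewrite mulrA; exact.
Qed.

Lemma circle_periodic z0 : circle z0 (2 * pi) = circle z0 0.
Proof. by rewrite /circle /cexp /= mulr_natl cos2pi sin2pi cos0 sin0. Qed.

Section fixed_circle.
Variable z0 : C.
Hypothesis z00 : z0 != 0.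

Let cRe phi : continuous_star phi -> continuous (fun t => complex.Re (phi (circle z0 t))).
Proof.
move=> cphi t; have c1 := velocity_cvg (circle_velocity z0 t).
have c2 := cvg_comp _ _ c1 (cphi _ (circle_neq0 t z00)).
exact: (cvg_comp _ _ c2 (@continuous_Re R _)).
Qed.

Let cIm phi : continuous_star phi -> continuous (fun t => complex.Im (phi (circle z0 t))).
Proof.
move=> cphi t; have c1 := velocity_cvg (circle_velocity z0 t).
have c2 := cvg_comp _ _ c1 (cphi _ (circle_neq0 t z00)).
exact: (cvg_comp _ _ c2 (@continuous_Im R _)).
Qed.

Lemma eq_cint phi psi : (forall z, z != 0 -> phi z = psi z) -> cint z0 phi = cint z0 psi.
Proof. by move=> h; rewrite /cint; congr (rint _ +i* rint _); apply/funext => t; rewrite h //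
  circle_neq0. Qed.

Lemma eq_circle_cint phi psi : (forall t, phi (circle z0 t) = psi (circle z0 t)) -> cint z0 phi =
  cint z0 psi.
Proof. by move=> h; rewrite /cint; congr (rint _ +i* rint _); apply/funext => t; rewrite h. Qed.

Lemma cintD phi psi : continuous_star phi -> continuous_star psi ->
  cint z0 (fun z => phi z + psi z) = cint z0 phi + cint z0 psi.
Proof.
move=> c1 c2; rewrite /cint -[RHS]/((_ + _) +i* (_ + _)).
rewrite -(rintD (cRe c1) (cRe c2)) -(rintD (cIm c1) (cIm c2)).
by congr (rint _ +i* rint _); apply/funext => t; case: (phi _) (psi _) => ? ? [].
Qed.

Lemma cintZ (s : C) phi : continuous_star phi ->
  cint z0 (fun z => s * phi z) = s * cint z0 phi.
Proof.
move=> c1; case: s => x y; rewrite /cint -[RHS]/((_ - _) +i* (_ + _)) /=.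
have cZ (r : R) f : continuous f -> continuous (fun t => r * f t).
  by move=> cf t; exact: (cvgM (cvg_cst r) (cf t)).
rewrite -!(rintZ _ (cRe c1)) -!(rintZ _ (cIm c1)) -mulN1r -(rintZ (-1) (cZ _ _ (cIm c1))).
rewrite -(rintD (cZ x _ (cRe c1)) (cZ (-1) _ (cZ y _ (cIm c1)))).
rewrite -(rintD (cZ x _ (cIm c1)) (cZ y _ (cRe c1))).
by congr (rint _ +i* rint _); apply/funext => t; case: (phi _) => ? ? /=; ring.
Qed.

Lemma cint1 : cint z0 (fun=> 1) = (2 * pi)%:C.
Proof. by rewrite /cint /= !rint_cst mul1r mul0r. Qed.

Lemma cint_conj phi : continuous_star phi -> cint z0 (fun z => cconj (phi z)) = cconj (cint z0 phi).
Proof.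
move=> c1; rewrite /cint /=; congr (_ +i* _).
  by congr rint; apply/funext => t; case: (phi _).
rewrite -mulN1r -(rintZ _ (cIm c1)); congr rint; apply/funext => t; case: (phi _) => ? ? /=; ring.
Qed.

Lemma cint_sqr_ge0 phi : 0 <= complex.Re (cint z0 (fun z => phi z * cconj (phi z))).
Proof.
apply: rint_ge0 => t; case: (phi _) => x y /=.
by rewrite mulrN opprK addr_ge0 // sqr_ge0.
Qed.

(** Here psi = z phi'. Along the circle the derivative of phi in the angle is i psi, and the circle
    closes up, so the integral of psi is a difference of equal endpoint values. *)
Lemma cint_theta phi psi : (forall z : C, z != 0 -> is_derive z 1 phi (psi z / z)) ->
  continuous_star psi -> cint z0 psi = 0.
Proof.
move=> dphi cpsi.
have v t : is_velocity t (phi \o circle z0) (psi (circle z0 t) * 'i%C).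
  have := velocity_comp (dphi _ (circle_neq0 t z00)) (circle_velocity z0 t).
  by rewrite mulrA divfK ?circle_neq0.
have vIm (t : R) : is_derive t 1 (fun s => complex.Im (phi (circle z0 s))) (complex.Re (psi
  (circle z0 t))).
  by have [_] := v t; rewrite ImiRe.
have vRe (t : R) : is_derive t 1 (fun s => complex.Re (phi (circle z0 s))) (- complex.Im (psi
  (circle z0 t))).
  by have [+ _] := v t; rewrite ReiNIm.
have cN : continuous (fun t => - complex.Im (psi (circle z0 t))).
  by move=> t; apply: (@cvgN _ _ _ (nbhs t)); exact: (cIm cpsi).
have e1 := rint_derive vIm (cRe cpsi); have e2 := rint_derive vRe cN.
rewrite circle_periodic subrr in e1; rewrite circle_periodic subrr in e2.
rewrite /cint e1; congr (_ +i* _).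
have := rintZ (-1) cN; rewrite e2 mulr0 => <-.
by congr rint; apply/funext => t; rewrite mulN1r opprK.
Qed.

End fixed_circle.
End circle_integral.

(** * Fourier coefficients on a circle *)

Section star.
Variable R : realType.
Local Notation C := (Cplx R).
Implicit Types (phi psi : C -> C) (z : C) (k : int).

Lemma is_derive_inv (z : C) : z != 0 -> is_derive z 1 (fun w : C => w^-1) (- z^-1 / z).
Proof.
move=> z0; apply: (@slope_is_derive _ _ (fun w => - w^-1 / z)).
  have ci : (fun w : C => w) @ z --> z by exact: cvg_id.
  have H : \forall w \near z, w != 0 by exact: (cvgr_neq0 (FF := nbhs_filter z) _ ci z0).
  near=> w; have w0 : w != 0 by near: w.
  by field; apply/andP.
have h : (fun w : C => w^-1) @ z --> z^-1 by exact: (cvgV (FF := nbhs_filter z) z0 cvg_id).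
exact: (cvgM (FF := nbhs_filter z) (cvgN (FF := nbhs_filter z) h) (cvg_cst (FF := nbhs_filter z)
  z^-1)).
Unshelve. all: by end_near. Qed.

Lemma is_derive_expn (n : nat) z : z != 0 -> is_derive z 1 (fun w : C => w ^+ n) (n%:R * z ^+ n /
  z).
Proof.
move=> z0; elim: n => [|n IH]; first by rewrite !mul0r; exact: is_derive_cst.
have h := is_deriveM (is_derive_id z 1) IH.
have -> : (fun w : C => w ^+ n.+1) = (id * (fun w : C => w ^+ n))%R.
  by apply/funext => w; rewrite exprS.
have -> : n.+1%:R * z ^+ n.+1 / z = id z *: (n%:R * z ^+ n / z) + z ^+ n *: 1.
  by rewrite /GRing.scale /= exprS -natr1; field.
exact: h.
Qed.

Lemma is_derive_expz k z : z != 0 -> is_derive z 1 (fun w : C => w ^ k) (k%:~R * z ^ k / z).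
Proof.
move=> z0; case: k => n; first exact: is_derive_expn.
have zn0 : z ^+ n.+1 != 0 by rewrite expf_neq0.
have h := @is_derive_comp C (fun w => w^-1) (fun w => w ^+ n.+1) z _ _ (is_derive_inv zn0)
  (is_derive_expn n.+1 z0).
have -> : (Negz n)%:~R * z ^ Negz n / z = - (z ^+ n.+1)^-1 / z ^+ n.+1 * (n.+1%:R * z ^+ n.+1 / z).
  by rewrite NegzE -exprnN mulrNz; field; apply/andP.
exact: h.
Qed.

Lemma derive_star phi (dphi : C -> C) : (forall z : C, z != 0 -> is_derive z 1 phi (dphi z)) ->
  continuous_star phi.
Proof. by move=> h z z0; exact: is_derive_cvg (h z z0). Qed.

Lemma expz_star k : continuous_star (fun w : C => w ^ k).
Proof. exact: (derive_star (@is_derive_expz k)). Qed.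

Lemma cst_star (s : C) : continuous_star (fun=> s).
Proof. by move=> z _; exact: (cvg_cst (FF := nbhs_filter z) s). Qed.

Lemma addr_star phi psi : continuous_star phi -> continuous_star psi ->
  continuous_star (fun z => phi z + psi z).
Proof. by move=> h1 h2 z z0; exact: (cvgD (FF := nbhs_filter z) (h1 z z0) (h2 z z0)). Qed.

Lemma mulr_star phi psi : continuous_star phi -> continuous_star psi ->
  continuous_star (fun z => phi z * psi z).
Proof. by move=> h1 h2 z z0; exact: (cvgM (FF := nbhs_filter z) (h1 z z0) (h2 z z0)). Qed.

Lemma conj_star phi : continuous_star phi -> continuous_star (fun z => cconj (phi z)).
Proof.
move=> h z z0; have h1 := cvg_comp _ _ (h z z0) (@continuous_Re R _).
have h2 := cvgN (FF := nbhs_filter z) (cvg_comp _ _ (h z z0) (@continuous_Im R _)).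
have := @cvg_Cplx R C (nbhs z) (nbhs_filter z) (fun w => complex.Re (phi w) -i* complex.Im (phi w))
   (complex.Re (phi z) -i* complex.Im (phi z)) h1 h2.
have e (w : C) : cconj w = complex.Re w -i* complex.Im w by case: w.
have -> : (fun w => cconj (phi w)) = (fun w => complex.Re (phi w) -i* complex.Im (phi w)).
  by apply/funext => w; rewrite e.
by rewrite e => h3; exact: h3.
Qed.

Variable z0 : C.
Hypothesis z00 : z0 != 0.

(** On the circle through [z0] this is exp(ikt); unlike that function of t, it is defined and
    holomorphic on the whole punctured plane. *)
Definition mode k z := (z / z0) ^ k.

Lemma mode0 z : mode 0 z = 1. Proof. by []. Qed.

Lemma modeD j k z : z != 0 -> mode (j + k) z = mode j z * mode k z.
Proof. by move=> h; rewrite /mode expfzDr // mulf_neq0 // invr_neq0. Qed.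

Lemma modeE k z : mode k z = z0 ^ (- k) * z ^ k.
Proof. by rewrite /mode expfzMl exprz_inv mulrC. Qed.

Lemma mode_star k : continuous_star (mode k).
Proof.
have -> : mode k = (fun z => z0 ^ (- k) * z ^ k) by apply/funext => z; exact: modeE.
exact: (mulr_star (@cst_star _) (@expz_star k)).
Qed.

Lemma mode_conj k t : cconj (mode k (circle z0 t)) = mode (- k) (circle z0 t).
Proof.
rewrite /mode /circle [z0 * _]mulrC mulfK //; set u := cexp _.
have uu : cconj u = u^-1.
  apply: (mulfI (cexp_neq0 _ : u != 0)); rewrite divff ?cexp_neq0 // /u /cexp /= expR0 !mul1r.
  apply/eqP; rewrite eq_complex /= -(cos2Dsin2 t); apply/andP; split; apply/eqP; ring.
rewrite -exprz_inv -uu; case: k => n; first exact: cconjX.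
by rewrite NegzE -!exprnN -cconjX -cconjV.
Qed.

Lemma is_derive_mode k z : z != 0 -> is_derive z 1 (mode k) (k%:~R * mode k z / z).
Proof.
move=> hz; have h := is_deriveZ (z0 ^ (- k)) (is_derive_expz k hz).
have -> : mode k = (z0 ^ (- k)) \*: (fun z => z ^ k) by apply/funext => w; exact: modeE.
have -> : k%:~R * ((z0 ^ (- k)) \*: (fun z => z ^ k)) z / z = z0 ^ (- k) * (k%:~R * z ^ k / z).
  by rewrite /= /GRing.scale /=; ring.
exact: h.
Qed.

Lemma cint_mode k : k != 0 -> cint z0 (mode k) = 0.
Proof.
move=> k0; have h := cint_theta z00 (fun z hz => is_derive_mode k hz)
  (mulr_star (@cst_star k%:~R) (@mode_star k)).
move/eqP: h; rewrite (cintZ z00 _ (@mode_star k)) mulf_eq0 intr_eq0 (negPf k0).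
by move/eqP.
Qed.

(** The Fourier coefficient times 2 pi. Using [mode (- k)] in place of the conjugate of [mode k],
    equal to it on the circle, keeps the integrand differentiable when [phi] is, so that
    [cint_theta] applies. *)
Definition fcoef phi k : C := cint z0 (fun z => phi z * mode (- k) z).

Definition energy phi : R := complex.Re (cint z0 (fun z => phi z * cconj (phi z))).

Let pi20 : 0 < 2 * pi :> R. Proof. by rewrite mulr_gt0 // pi_gt0. Qed.

Lemma fcoefD phi psi k : continuous_star phi -> continuous_star psi ->
  fcoef (fun z => phi z + psi z) k = fcoef phi k + fcoef psi k.
Proof.
move=> h1 h2; have m := @mode_star (- k).
rewrite /fcoef -(cintD z00 (mulr_star h1 m) (mulr_star h2 m)).
by apply: eq_cint => // z _; rewrite mulrDl.
Qed.

Lemma fcoefZ (s : C) phi k : continuous_star phi ->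
  fcoef (fun z => s * phi z) k = s * fcoef phi k.
Proof.
move=> h1; have m := @mode_star (- k); rewrite /fcoef -(cintZ z00 s (mulr_star h1 m)).
by apply: eq_cint => // z _; rewrite mulrA.
Qed.

Lemma fcoef_mode j k : fcoef (mode j) k = if j == k then (2 * pi)%:C else 0.
Proof.
have -> : fcoef (mode j) k = cint z0 (mode (j - k)).
  by apply: eq_cint => // z hz; rewrite modeD.
case: eqP => [->|/eqP jk]; last by rewrite cint_mode // subr_eq0.
by rewrite subrr cint1.
Qed.

Let remove_mode (p s u v : C) : u * v = 1 -> cconj u = v ->
  (p - s * u) * cconj (p - s * u) =
  (p * cconj p + - cconj s * (p * v)) + (- s * cconj (p * v) + s * cconj s).
Proof.
move=> uv uJ; have vJ : cconj v = u by rewrite -uJ cconjK.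
rewrite cconjB !cconjM vJ uJ; have -> : s * cconj s = s * cconj s * (u * v) by rewrite uv mulr1.
ring.
Qed.

(** Pythagoras: the subtracted term is the orthogonal projection of [phi] onto [mode k] in the
    square-integrable functions on the circle. *)
Lemma energy_remove phi k : continuous_star phi ->
  energy (fun z => phi z - fcoef phi k / (2 * pi)%:C * mode k z) =
  energy phi - cabs (fcoef phi k) ^+ 2 / (2 * pi).
Proof.
move=> h1; set H := fcoef phi k; set s := H / _.
have m := @mode_star k; have m' := @mode_star (- k); have h2 := conj_star h1.
rewrite /energy.
rewrite (@eq_circle_cint R z0 _ (fun z => (phi z * cconj (phi z) + - cconj s * (phi z * mode (-
  k) z)) +
   (- s * cconj (phi z * mode (- k) z) + s * cconj s ))); last first.
  move=> t; apply: remove_mode; last exact: mode_conj.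
  by rewrite -modeD ?circle_neq0 // subrr mode0.
have ss : continuous_star (fun z => - cconj s * (phi z * mode (- k) z)).
  exact: (mulr_star (@cst_star _) (mulr_star h1 m')).
have ss2 : continuous_star (fun z => - s * cconj (phi z * mode (- k) z)).
  exact: (mulr_star (@cst_star _) (conj_star (mulr_star h1 m'))).
rewrite (cintD z00 (addr_star (mulr_star h1 h2) ss) (addr_star ss2 (@cst_star _))).
rewrite (cintD z00 (mulr_star h1 h2) ss) (cintD z00 ss2 (@cst_star _)).
rewrite (cintZ z00 _ (mulr_star h1 m')) (cintZ z00 _ (conj_star (mulr_star h1 m'))).
rewrite (cint_conj z00 (mulr_star h1 m')) -/(fcoef phi k) -/H.
have -> : cint z0 (fun=> s * cconj s) = s * cconj s * (2 * pi)%:C.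
  by rewrite -(cint1 z0) -(cintZ z00 _ (@cst_star 1)); apply: eq_cint => // z _; rewrite mulr1.
have sE : s * (2 * pi)%:C = H by rewrite /s divfK // fmorph_eq0 gt_eqF.
rewrite mulrAC sE.
have -> : cint z0 (fun z => phi z * cconj (phi z)) + - cconj s * H + (- s * cconj H + H * cconj s) =
    cint z0 (fun z => phi z * cconj (phi z)) - (cabs H ^+ 2 / (2 * pi))%:C.
  have -> : (cabs H ^+ 2 / (2 * pi))%:C = H * cconj H / (2 * pi)%:C :> C.
    by rewrite mul_cconj; exact: (fmorph_div (real_complex R)).
  rewrite /s; ring.
by case: (cint _ _) => x y /=.
Qed.

(* Removing one mode at a time leaves the other coefficients unchanged. *)
Lemma bessel (s : seq int) phi : uniq s -> continuous_star phi ->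
  \sum_(k <- s) cabs (fcoef phi k) ^+ 2 / (2 * pi) <= energy phi.
Proof.
elim: s phi => [|k s IH] phi /=; first by rewrite big_nil => _ _; exact: cint_sqr_ge0.
move=> /andP[ks us] h1; rewrite big_cons.
have hs : continuous_star (fun z => - (fcoef phi k / (2 * pi)%:C) * mode k z).
  exact: (mulr_star (@cst_star _) (@mode_star k)).
have eN : (fun z => phi z - fcoef phi k / (2 * pi)%:C * mode k z) =
   (fun z => phi z + - (fcoef phi k / (2 * pi)%:C) * mode k z).
  by apply/funext => z; rewrite mulNr.
have := IH _ us (addr_star h1 hs); rewrite -eN energy_remove // eN.
rewrite (eq_big_seq (fun j => cabs (fcoef phi j) ^+ 2 / (2 * pi))); first lra.
move=> j js; rewrite fcoefD // fcoefZ ?fcoef_mode; last exact: mode_star.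
by case: eqP js ks => [->|_] js ks; [rewrite js in ks|rewrite mulr0 addr0].
Qed.

Lemma fcoef_bounded phi : continuous_star phi -> exists B, forall k, cabs (fcoef phi k) <= B.
Proof.
(* Since x^2 <= e implies x <= 1 + e, no square root is taken. *)
move=> h1; exists (1 + energy phi * (2 * pi)) => k.
have := bessel (s := [:: k]) isT h1; rewrite big_seq1 ler_pdivrMr // => h.
have e0 : 0 <= energy phi * (2 * pi) := le_trans (sqr_ge0 _) h.
rewrite leNgt; apply/negP => lt; have := cabs_ge0 (fcoef phi k); nra.
Qed.

(** By [bessel], N equal coefficients cost N |H|^2 / (2 pi) of a fixed finite energy, for every
    N. *)
Lemma fcoef_const_eq0 phi (e : nat -> int) (H : C) : continuous_star phi -> injective e ->
  (forall j, fcoef phi (e j) = H) -> H = 0.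
Proof.
move=> h1 ie eH; apply/eqP; rewrite -cabs_eq0; apply/negPn/negP => H0.
have Hp : 0 < cabs H ^+ 2 / (2 * pi) by rewrite divr_gt0 // exprn_gt0 // lt_def H0 cabs_ge0.
have N_le N : N%:R * (cabs H ^+ 2 / (2 * pi)) <= energy phi.
  have := bessel (s := map e (iota 0 N)) _ h1; rewrite map_inj_uniq // iota_uniq => /(_ isT).
  rewrite big_map (eq_bigr (fun=> cabs H ^+ 2 / (2 * pi))); last by move=> j _; rewrite eH.
  rewrite big_const_seq count_predT size_iota iter_addr_0 -[_ *+ N]mulr_natl; exact.
have := N_le (Num.bound (energy phi / (cabs H ^+ 2 / (2 * pi)))).
rewrite -ler_pdivlMr // leNgt; have e0 : 0 <= energy phi by exact: cint_sqr_ge0.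
by rewrite archi_boundP // divr_ge0 // ltW.
Qed.

(* Write [phi z - phi z0 = G z * (z - z0)]. If all coefficients of [phi] vanish, those of [G]
   are constant on [k >= 0] and on [k < 0], hence zero by Bessel, and then [k = 0] gives
   [phi z0 = 0]. *)
Lemma fcoef_eq0 phi (dphi : C -> C) : (forall z : C, z != 0 -> is_derive z 1 phi (dphi z)) ->
  (forall k, fcoef phi k = 0) -> phi z0 = 0.
Proof.
move=> dp f0; have cp := derive_star dp.
have [G [hG cG _]] := is_derive_slope (dp _ z00).
have sG : continuous_star G.
  move=> z hz; have [->|zz] := eqVneq z z0; first exact: cG.
  have zz0 : z - z0 != 0 by rewrite subr_eq0.
  have GE w : w - z0 != 0 -> G w = (phi w - phi z0) / (w - z0) by move=> h; rewrite hG mulfK.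
  have c1 : (fun w : C => w - z0) @ z --> z - z0.
    have ci : (fun w : C => w) @ z --> z by exact: cvg_id.
    exact: (cvgB (FF := nbhs_filter z) ci (cvg_cst (FF := nbhs_filter z) z0)).
  have c2 : (fun w : C => phi w - phi z0) @ z --> phi z - phi z0.
    exact: (cvgB (FF := nbhs_filter z) (cp z hz) (cvg_cst (FF := nbhs_filter z) (phi z0))).
  have c3 := cvgM (FF := nbhs_filter z) c2 (cvgV (FF := nbhs_filter z) zz0 c1).
  have c4 : \forall w \near z, w - z0 != 0 by exact: (cvgr_neq0 (FF := nbhs_filter z) _ c1 zz0).
  have c5 : {near z, (fun w => (phi w - phi z0) * (w - z0)^-1) =1 G}.
    near=> w; have w0 : w - z0 != 0 by near: w; exact: c4.
    by rewrite (GE w w0).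
  rewrite (GE z zz0).
  have c6 := near_eq_cvg (FF := nbhs_filter z) c5.
  exact: (cvg_trans c6 c3).
(* As z - z0 = z0 * (mode 1 z - 1), vanishing coefficients of [phi] turn into a first-order
   difference equation for those of [G], with a source only at k = 0. *)
have rel k : z0 * fcoef G k = z0 * fcoef G (k - 1) + phi z0 * (if k == 0 then (2 * pi)%:C else 0).
  have gE : fcoef phi k = fcoef (fun z => phi z0 * mode 0 z + (z0 * (G z * mode 1 z) + - z0 * G
    z)) k.
    apply: eq_cint => // z _; congr (_ * _); rewrite mode0 mulr1 /mode expr1z.
    have -> : phi z = phi z0 + G z * (z - z0) by rewrite -hG addrC subrK.
    by field.
  have sG1 : continuous_star (fun z => G z * mode 1 z) := mulr_star sG (@mode_star 1).
  have := f0 k; rewrite gE fcoefD; last 2 first.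
  - exact: (mulr_star (@cst_star _) (@mode_star 0)).
  - exact: (addr_star (mulr_star (@cst_star _) sG1) (mulr_star (@cst_star _) sG)).
  rewrite fcoefD; [|exact: (mulr_star (@cst_star _) sG1)|exact: (mulr_star (@cst_star _) sG)].
  rewrite (fcoefZ _ _ (@mode_star 0)) (fcoefZ _ _ sG1) (fcoefZ _ _ sG).
  rewrite fcoef_mode eq_sym.
  have -> : fcoef (fun z => G z * mode 1 z) k = fcoef G (k - 1).
    by apply: eq_cint => // z hz; rewrite -mulrA -modeD // opprB.
  rewrite mulNr addrA => /eqP; rewrite subr_eq0 => /eqP <-; exact: addrC.
have Hk k : k != 0 -> fcoef G k = fcoef G (k - 1).
  by move=> k0; apply: (mulfI z00); rewrite rel (negPf k0) mulr0 addr0.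
have H0 : fcoef G 0 = 0.
  apply: (@fcoef_const_eq0 G Posz) => //; first by move=> x y [].
  by elim=> // j <-; rewrite Hk // intS addrC addKr.
have H1 : fcoef G (-1) = 0.
  apply: (@fcoef_const_eq0 G Negz) => //; first by move=> x y [].
  elim=> // j <-; rewrite [RHS]Hk //; congr fcoef; rewrite !NegzE; lia.
have := rel 0; rewrite eqxx H0 sub0r H1 mulr0 add0r => /esym/eqP.
by rewrite mulf_eq0 fmorph_eq0 (gt_eqF pi20) orbF => /eqP.
Unshelve. all: by end_near. Qed.

End star.

(** * Laurent series *)

Section laurent.
Variable R : realType.
Local Notation C := (Cplx R).
Implicit Types (a c : int -> C) (z : C).

Definition laurent_coef a :=
  entire_coef (fun j => a (Posz j)) /\ entire_coef (fun j => a (Negz j)).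

(** [Negz j] is the index -(j+1), whence the extra factor z^-1. *)
Definition lsum a z : C :=
  psum (fun j => a (Posz j)) z + z^-1 * psum (fun j => a (Negz j)) z^-1.

Lemma laurent_coefD a c : laurent_coef a -> laurent_coef c -> laurent_coef (fun k => a k + c k).
Proof. by move=> [a1 a2] [c1 c2]; split; apply: entire_coefD. Qed.

Lemma laurent_coefZ (s : C) a : laurent_coef a -> laurent_coef (fun k => s * a k).
Proof. by move=> [a1 a2]; split; apply: entire_coefZ. Qed.

Lemma laurent_coef_index a : laurent_coef a -> laurent_coef (fun k => k%:~R * a k).
Proof.
move=> [a1 a2]; split.
  apply: (@entire_coefM _ _ (fun j => (Posz j)%:~R) 1 _ a1) => j.
  by rewrite mul1r cabs_nat -natrX ler_nat ltnW // ltn_expl.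
apply: (@entire_coefM _ _ (fun j => (Negz j)%:~R) 2 _ a2) => j.
by rewrite NegzE mulrNz cabsN cabs_nat -exprS -natrX ler_nat ltnW // ltn_expl.
Qed.

Lemma laurent_coef_pred a : laurent_coef a -> laurent_coef (fun k => a (k - 1)).
Proof.
move=> [a1 a2]; split.
  apply: entire_coef_cons; have -> : (fun k => a (Posz k.+1 - 1)) = (fun j => a (Posz j)).
    by apply/funext => k; rewrite intS addrC addKr.
  exact: a1.
have -> : (fun j => a (Negz j - 1)) = (fun j => a (Negz j.+1)).
  by apply/funext => k; congr a; rewrite !NegzE; lia.
exact: (entire_coefS a2).
Qed.

Lemma laurent_coef_succ a : laurent_coef a -> laurent_coef (fun k => a (k + 1)).
Proof.
move=> [a1 a2]; split.
  have -> : (fun j => a (Posz j + 1)) = (fun j => a (Posz j.+1)).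
    by apply/funext => k; congr a; lia.
  exact: (entire_coefS a1).
apply: entire_coef_cons; have -> : (fun k => a (Negz k.+1 + 1)) = (fun j => a (Negz j)).
  by apply/funext => k; congr a; rewrite !NegzE; lia.
exact: a2.
Qed.

Lemma lsumD a c z : laurent_coef a -> laurent_coef c ->
  lsum (fun k => a k + c k) z = lsum a z + lsum c z.
Proof. by move=> [a1 a2] [c1 c2]; rewrite /lsum !psumD // mulrDr addrACA. Qed.

Lemma lsumZ (s : C) a z : laurent_coef a -> lsum (fun k => s * a k) z = s * lsum a z.
Proof. by move=> [a1 a2]; rewrite /lsum !psumZ // mulrDr mulrCA. Qed.

Lemma lsum_pred a z : laurent_coef a -> z != 0 -> lsum (fun k => a (k - 1)) z = z * lsum a z.
Proof.
move=> ha z0; have [h1 h2] := laurent_coef_pred ha; have [a1 a2] := ha.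
rewrite /lsum psum_recl // [psum (fun j => a (Negz j)) _]psum_recl //.
have -> : (fun k => a (Posz k.+1 - 1)) = (fun j => a (Posz j)).
  by apply/funext => k; rewrite intS addrC addKr.
have -> : (fun j => a (Negz j - 1)) = (fun j => a (Negz j.+1)).
  by apply/funext => k; congr a; rewrite !NegzE; lia.
have -> : Posz 0 - 1 = Negz 0 by [].
by move: (psum _ z) (psum _ z^-1) => p q; field.
Qed.

Lemma lsum_succ a z : laurent_coef a -> z != 0 -> lsum (fun k => a (k + 1)) z = z^-1 * lsum a z.
Proof.
move=> ha z0; apply: (mulfI z0); rewrite -(lsum_pred (laurent_coef_succ ha) z0) mulVKf //.
by have -> : (fun k => a (k - 1 + 1)) = a by apply/funext => k; rewrite subrK.
Qed.

Lemma is_derive_lsum a z : laurent_coef a -> z != 0 ->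
  is_derive z 1 (lsum a) (lsum (fun k => k%:~R * a k) z / z).
Proof.
move=> ha z0; have [a1 a2] := ha; have [k1 k2] := laurent_coef_index ha.
have d1 := is_derive_psum z a1.
have dinv := is_derive_inv z0.
have d2 := @is_derive_comp C (psum (fun j => a (Negz j))) (fun w => w^-1) z _ _ (is_derive_psum
  z^-1 a2) dinv.
have d := is_deriveD d1 (is_deriveM dinv d2).
have -> : lsum a = (psum (fun j => a (Posz j)) + (fun w => w^-1) * (psum (fun j => a (Negz j)) \o
  (fun w : C => w^-1)))%R by [].
have -> : lsum (fun k => k%:~R * a k) z / z = psum (fun k => k.+1%:R * a (Posz k.+1)) z +
  (z^-1 * (psum (fun k => k.+1%:R * a (Negz k.+1)) z^-1 * (- z^-1 / z)) +
     psum (fun j => a (Negz j)) z^-1 * (- z^-1 / z)).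
  rewrite /lsum [psum (fun j => (Posz j)%:~R * _) z]psum_recl // mul0r add0r.
  have -> : psum (fun j => (Negz j)%:~R * a (Negz j)) z^-1 =
      - psum (fun j => a (Negz j)) z^-1 - z^-1 * psum (fun k => k.+1%:R * a (Negz k.+1)) z^-1.
    rewrite psum_recl // [psum (fun j => a (Negz j)) _]psum_recl //.
    have -> : (fun k => (Negz k.+1)%:~R * a (Negz k.+1)) =
        (fun k => -1 * (k.+1%:R * a (Negz k.+1)) + -1 * a (Negz k.+1)).
      by apply/funext => k; rewrite NegzE mulrNz -natr1; ring.
    have e1 := entire_coefS a2; have e2 := entire_coef_diff a2.
    rewrite (psumD _ (entire_coefZ (-1) e2) (entire_coefZ (-1) e1)) (psumZ _ _ e2) (psumZ _ _ e1).
    by rewrite NegzE mulrNz; ring.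
  by move: (psum _ z) (psum _ z^-1) (psum _ z^-1) => p q r; field.
exact: d.
Qed.

Lemma entire_coef0 : entire_coef (fun=> 0 : C).
Proof. by move=> r r0; exists 0 => k; rewrite cabs0 mul0r. Qed.

Lemma psum0 z : psum (fun=> 0) z = 0.
Proof.
have -> : (fun=> 0) = (fun k : nat => 0 * (0 : C)) by apply/funext => k; rewrite mulr0.
by rewrite (psumZ 0 _ entire_coef0) mul0r.
Qed.

Lemma lsum0 z : lsum (fun=> 0) z = 0.
Proof. by rewrite /lsum !psum0 mulr0 addr0. Qed.

(* Dividing the other coefficients by their index gives a primitive for [z d/dz], so the
   circle integral only sees the constant term. *)
Lemma lsum_eq0 a : laurent_coef a -> (forall z, z != 0 -> lsum a z = 0) -> a 0 = 0.
Proof.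
move=> ha a0.
pose t (k : int) : C := if k == 0 then 0 else k%:~R^-1.
have t1 k : cabs (t k) <= 1.
  rewrite /t; case: eqP => [_|/eqP k0]; first by rewrite cabs0.
  have ki : 1 <= cabs (k%:~R : C).
    case: k k0 => [[|j]|j] // _; first by rewrite cabs_nat ler1n.
    by rewrite NegzE mulrNz cabsN cabs_nat ler1n.
  by rewrite cabsV invf_le1 //; apply: lt_le_trans ki.
have t2 k (j : nat) : cabs (t k) <= 1 * 2 ^+ j.
  by rewrite mul1r; apply: le_trans (t1 k) _; rewrite exprn_ege1 // ler1n.
have ht : laurent_coef (fun k => t k * a k).
  by have [a1 a2] := ha; split; [apply: (entire_coefM (t := fun j => t (Posz j)) _ a1) => j;
    exact: t2|
     apply: (entire_coefM (t := fun j => t (Negz j)) _ a2) => j; exact: t2].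
(* Adding [d] deletes the constant term, the only one that is not k times something; [a + d] is then
   the image under z d/dz of the series with coefficients [t k * a k]. *)
pose d (k : int) : C := if k == 0 then - a 0 else 0.
have hd : laurent_coef d.
  by split; [apply: entire_coef_cons; exact: entire_coef0|exact: entire_coef0].
have ld z : lsum d z = - a 0.
  have [d1 d2] := hd; rewrite /lsum (psum_recl z d1) (psum0 z) (psum0 z^-1).
  by rewrite !mulr0 !addr0.
have E : (fun k => k%:~R * (t k * a k)) = (fun k => a k + d k).
  apply/funext => k; rewrite /t /d; case: eqP => [->|/eqP k0]; first by rewrite mul0r addrN.
  by rewrite mulVKf ?intr_eq0 // addr0.
have sE z : z != 0 -> lsum (fun k => a k + d k) z = - a 0.
  by move=> z0; rewrite lsumD // a0 // ld add0r.
have sst : continuous_star (lsum (fun k => a k + d k)).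
  apply: (derive_star (dphi := fun z => lsum (fun k => k%:~R * (a k + d k)) z / z)) => z z0.
  by apply: is_derive_lsum z0; exact: laurent_coefD.
have dt (z : C) : z != 0 -> is_derive z 1 (lsum (fun k => t k * a k)) (lsum (fun k => a k + d k)
  z / z).
  by move=> z0; rewrite -E; exact: is_derive_lsum.
have := cint_theta (oner_neq0 C) dt sst.
rewrite (eq_cint (oner_neq0 C) (psi := fun=> - a 0 * 1)); last first.
  by move=> z z0; rewrite sE // mulr1.
rewrite (cintZ (oner_neq0 C) _ (@cst_star R 1)) cint1 => /eqP.
by rewrite mulf_eq0 oppr_eq0 fmorph_eq0 (gt_eqF (mulr_gt0 (ltr0Sn R 1) (pi_gt0 R))) orbF => /eqP.
Qed.

(** * Laurent series satisfying the recurrence solve the equation *)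

Section solution.
Variables (n lam mu b : C) (a : int -> C).
Hypothesis ha : laurent_coef a.
Hypothesis rec : forall k : int,
  ((k%:~R + b) * (k%:~R + b + n - 1) + lam) * a k + mu * (k%:~R + 1 + b) * a (k + 1)
  - mu * (k%:~R - 1 + b + n) * a (k - 1) = 0.

(** The action of theta = z d/dz on the coefficients of z^b times a Laurent series. *)
Let indexb c := fun k : int => (k%:~R + b) * c k.

Let indexbE c : indexb c = (fun k => k%:~R * c k + b * c k).
Proof. by apply/funext => k; rewrite /indexb mulrDl. Qed.

Let laurent_indexb c : laurent_coef c -> laurent_coef (indexb c).
Proof. by move=> hc; rewrite indexbE; exact: (laurent_coefD (laurent_coef_index hc)
  (laurent_coefZ b hc)). Qed.

Let branch (L : C -> C) c z := cpow L b z * lsum c z.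

Let is_derive_branch U (L : C -> C) c z : log_branch U L -> U z -> z != 0 -> laurent_coef c ->
  is_derive z 1 (branch L c) (z^-1 * branch L (indexb c) z).
Proof.
move=> hL Uz z0 hc.
have h := is_deriveM (is_derive_cpow b hL Uz) (is_derive_lsum hc z0).
have -> : z^-1 * branch L (indexb c) z = cpow L b z * (lsum (fun k => k%:~R * c k) z / z)
    + lsum c z * (b / z * cpow L b z).
  rewrite /branch indexbE (lsumD z (laurent_coef_index hc) (laurent_coefZ b hc)) (lsumZ b z hc).
  ring.
exact: h.
Qed.

(** In terms of theta = z d/dz the equation is theta^2 E + (n - 1) theta E + lam E + (mu / z) theta
    E - mu z (theta + n) E = 0. On z^b times the series, theta becomes [indexb] and the factors 1/z
    and z shift the index, so the coefficient of z^(b+k) is exactly [rec k]. *)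
Lemma laurent_solution U (L : C -> C) : log_branch U L ->
  solves_on n lam mu U (fun z => cpow L b z * lsum a z).
Proof.
move=> hL; have [oU hol expL] := hL.
have U0 z : U z -> z != 0 by move=> /expL <-; exact: cexp_neq0.
have hb1 := laurent_indexb ha; have hb2 := laurent_indexb hb1.
have d1 z : U z -> is_derive z 1 (branch L a) (z^-1 * branch L (indexb a) z).
  by move=> Uz; apply: (is_derive_branch hL Uz (U0 z Uz) ha).
have e1 z : U z -> derive1 (branch L a) z = z^-1 * branch L (indexb a) z.
  by move=> Uz; rewrite derive1E; case: (d1 z Uz).
have d2 z : U z -> is_derive z 1 (derive1 (branch L a))
    (z^-1 * (z^-1 * branch L (indexb (indexb a)) z) + branch L (indexb a) z * (- z^-1 / z)).
  move=> Uz; have h := is_deriveM (is_derive_inv (U0 z Uz)) (is_derive_branch hL Uz (U0 z Uz) hb1).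
  apply: (near_eq_is_derive _ h).
  by apply: filterS (open_nbhs_nbhs (conj oU Uz)) => w Uw; rewrite e1.
split; [by move=> z /d1[]|by move=> z /d2[]|].
move=> z Uz; have z0 := U0 z Uz.
rewrite -/(branch L a) (derive1E (derive1 (branch L a))) (e1 z Uz).
have -> : 'D_1 (derive1 (branch L a)) z =
   z^-1 * (z^-1 * branch L (indexb (indexb a)) z) + branch L (indexb a) z * (- z^-1 / z).
  by case: (d2 z Uz).
rewrite -/(branch L a z) /branch.
have S0 : lsum (indexb (indexb a)) z + (n - 1) * lsum (indexb a) z + lam * lsum a z
    + mu * (z^-1 * lsum (indexb a) z) - mu * (z * (lsum (indexb a) z + n * lsum a z)) = 0.
  have hn := laurent_coefD hb1 (laurent_coefZ n ha).
  rewrite -(lsumZ n z ha) -(lsumD z hb1 (laurent_coefZ n ha)).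
  rewrite -(lsum_pred hn z0) -(lsum_succ hb1 z0) -mulNr.
  have hp := laurent_coef_pred hn; have hs := laurent_coef_succ hb1.
  rewrite -(lsumZ (- mu) z hp) -(lsumZ mu z hs) -(lsumZ (n - 1) z hb1) -(lsumZ lam z ha).
  have l1 := laurent_coefZ (n - 1) hb1; have l2 := laurent_coefZ lam ha.
  have l3 := laurent_coefZ mu hs; have l4 := laurent_coefZ (- mu) hp.
  rewrite -(lsumD z hb2 l1) -(lsumD z (laurent_coefD hb2 l1) l2).
  rewrite -(lsumD z (laurent_coefD (laurent_coefD hb2 l1) l2) l3).
  rewrite -(lsumD z (laurent_coefD (laurent_coefD (laurent_coefD hb2 l1) l2) l3) l4).
  rewrite -[RHS](lsum0 z); congr (lsum _ z); apply/funext => k.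
  rewrite -[RHS](rec k) /indexb rmorphB rmorphD /=; ring.
move: S0; move: (lsum (indexb (indexb a)) z) (lsum (indexb a) z) (lsum a z) (cpow L b z).
move=> s2 s1 s0 p S0.
rewrite [LHS](_ : _ = p * (s2 + (n - 1) * s1 + lam * s0 + mu * (z^-1 * s1) - mu * (z * (s1 + n *
  s0)))).
  by rewrite S0 mulr0.
by field.
Qed.

End solution.
End laurent.

(** * The recurrence of the equation *)

Section more_asymptotics.
Variable R : realType.
Local Notation C := (Cplx R).

(** The shape of every product [sigma j * y j] or [sigma j.+1 * y j] met in the Casoratian argument:
    rational in j of degree -1. *)
Lemma cvg_inv_shift2 (s e w1 w2 : C) :
  s * (1 + e * (j%:R + w1)^-1) * (j%:R + w2)^-1 @[j --> \oo] --> (0 : C).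
Proof.
have h1 : 1 + e * (j%:R + w1)^-1 @[j --> \oo] --> (1 : C).
  have h := cvgD (cvg_cst (1 : C)) (cvgM (cvg_cst e) (@cvg_inv_shift R w1)).
  by rewrite mulr0 addr0 in h; exact: h.
have h := cvgM (cvgM (cvg_cst s) h1) (@cvg_inv_shift R w2).
by rewrite mulr0 in h; exact: h.
Qed.

Lemma cvg_cabs_bounded (u : nat -> C) (l : C) : u k @[k --> \oo] --> l ->
  exists B, forall k, cabs (u k) <= B.
Proof.
move=> ul; have [N _ hN] : \forall k \near \oo, cabs (u k) <= cabs l + 1.
  have h := cvg_comp _ _ ul (@continuous_cabs R l).
  by move/cvgr_le: h; apply; lra.
have s0 : 0 <= \sum_(i < N) cabs (u i) by apply: sumr_ge0 => i _; exact: cabs_ge0.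
exists (\sum_(i < N) cabs (u i) + (cabs l + 1)) => k; have l0 := cabs_ge0 l.
have [Nk|kN] := leqP N k; first by have := hN k Nk; rewrite /=; lra.
rewrite (bigD1 (Ordinal kN)) //= -addrA lerDl addr_ge0 //; last by lra.
by apply: sumr_ge0 => i _; exact: cabs_ge0.
Qed.

End more_asymptotics.

Section heun.
Variable R : realType.
Local Notation C := (Cplx R).
Variables n lam mu b : C.
Hypothesis hmu : mu != 0.
Hypothesis hb : forall k : int, b != k%:~R.
Hypothesis hbn : forall k : int, b + n != k%:~R.

Let b_neq0 (k : int) : k%:~R + b != 0.
Proof. by apply/eqP => h; have /eqP := hb (- k); apply; rewrite rmorphN; apply/eqP; rewrite
  -addr_eq0 addrC h. Qed.

Let bn_neq0 (k : int) : k%:~R + b + n != 0.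
Proof. by apply/eqP => h; have /eqP := hbn (- k); apply; rewrite rmorphN; apply/eqP; rewrite
  -addr_eq0 addrC addrA h. Qed.

Definition recurrence (a : int -> C) := forall k : int,
  ((k%:~R + b) * (k%:~R + b + n - 1) + lam) * a k + mu * (k%:~R + 1 + b) * a (k + 1)
  - mu * (k%:~R - 1 + b + n) * a (k - 1) = 0.

(* [a_k = pweight k * alpha_(k+1)] for [k >= 0] and [a_(1-m) = qweight m * beta_m] turn the
   recurrence into the products of the [matM] and of the [matS]. *)
Definition pweight (j : nat) : C := \prod_(i < j) (mu / (i.+1%:R + b)).

Definition qweight (m : nat) : C := \prod_(i < m) (- mu / (b - i%:R + n - 2)).

Lemma pweightS j : pweight j.+1 = mu / (j.+1%:R + b) * pweight j.
Proof. by rewrite /pweight big_ord_recr /= mulrC. Qed.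

Lemma qweightS m : qweight m.+1 = - mu / (b - m%:R + n - 2) * qweight m.
Proof. by rewrite /qweight big_ord_recr /= mulrC. Qed.

Lemma pweight0 : pweight 0 = 1. Proof. by rewrite /pweight big_ord0. Qed.
Lemma qweight0 : qweight 0 = 1. Proof. by rewrite /qweight big_ord0. Qed.

Let dp (j : nat) : j%:R + b != 0. Proof. exact: (b_neq0 (Posz j)). Qed.
Let dpn (j : nat) : j%:R + b + n - 1 != 0.
Proof.
have -> : j%:R + b + n - 1 = (Posz j - 1)%:~R + b + n by rewrite rmorphB /=; ring.
exact: bn_neq0.
Qed.
Let dq1 (m : nat) : b - m%:R + 1 != 0.
Proof.
have -> : b - m%:R + 1 = (1 - Posz m)%:~R + b by rewrite rmorphB /=; ring.
exact: b_neq0.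
Qed.
Let dqn (m l : nat) : b - m%:R + n - l%:R != 0.
Proof.
have -> : b - m%:R + n - l%:R = (- Posz m - Posz l)%:~R + b + n by rewrite rmorphB rmorphN /=; ring.
exact: bn_neq0.
Qed.

Lemma pweight_neq0 j : pweight j != 0.
Proof. by elim: j => [|j IH]; rewrite ?pweight0 ?oner_neq0 // pweightS !mulf_neq0 ?invr_neq0 ?dp.
  Qed.

Lemma qweight_neq0 m : qweight m != 0.
Proof.
elim: m => [|m IH]; rewrite ?qweight0 ?oner_neq0 // qweightS !mulf_neq0 ?oppr_eq0 //.
by rewrite invr_neq0 // (dqn m 2).
Qed.

Lemma forward_solution : exists alpha : nat -> C,
  [/\ alpha k @[k --> \oo] --> (1 : C),
      forall k, alpha k = matM n lam mu b k 0 0 * alpha k.+1 + matM n lam mu b k 0 1 * alpha k.+2,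
      forall k, matR n lam mu b k 0 0 = alpha k &
      forall k, matR n lam mu b k 1 0 = alpha k.+1].
Proof.
apply: (@companion_quadratic R (matM n lam mu b) lam b (b + n - 1) (fun=> mu ^+ 2) (cabs (mu ^+
  2))).
- by move=> j; rewrite mxE.
- by move=> j; rewrite mxE.
- by move=> j; rewrite mxE /= !addrA.
- by move=> j; rewrite mxE /= !addrA.
- exact: nearW.
Qed.

Lemma backward_solution : exists beta : nat -> C,
  [/\ beta k @[k --> \oo] --> (1 : C),
      forall k, beta k = matS n lam mu b k 0 0 * beta k.+1 + matS n lam mu b k 0 1 * beta k.+2,
      forall k, matT n lam mu b k 0 0 = beta k &
      forall k, matT n lam mu b k 1 0 = beta k.+1].
Proof.
(* The upper right entry of [S_j] has three linear factors below and one above. Two of the lower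
   ones match the diagonal entry; the quotient of the remaining pair tends to 1 and is moved into
   the bounded numerator [t]. *)
pose t (j : nat) : C := mu ^+ 2 * (b - j%:R + n - 1) / (b - j%:R + n - 3).
have tE j : t j = mu ^+ 2 + - (mu ^+ 2 * 2) * (j%:R + (3 - b - n))^-1.
  rewrite /t; have h := dqn j 3.
  have e : j%:R + (3 - b - n) = - (b - j%:R + n - 3) by ring.
  have h' : j%:R + (3 - b - n) != 0 by rewrite e oppr_eq0.
  by field; apply/andP.
have ct : t j @[j --> \oo] --> mu ^+ 2.
  have h := cvgD (cvg_cst (mu ^+ 2)) (cvgM (cvg_cst (- (mu ^+ 2 * 2))) (@cvg_inv_shift R (3 - b -
    n))).
  rewrite mulr0 addr0 in h.
  have -> : t = (fun j => mu ^+ 2 + - (mu ^+ 2 * 2) * (j%:R + (3 - b - n))^-1) by apply/funext =>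
    j; exact: tE.
  exact: h.
have [K tK] := cvg_cabs_bounded ct.
apply: (@companion_quadratic R (matS n lam mu b) (lam - n + 2) (- b - 1) (- b - n + 2) t K).
- by move=> j; rewrite mxE.
- by move=> j; rewrite mxE.
- move=> j; rewrite mxE /=; congr (1 + _ / _); ring.
- move=> j; rewrite mxE /= /t.
  have -> : (j%:R + (- b - 1)) * (j%:R + (- b - n + 2)) = (b - j%:R + 1) * (b - j%:R + n - 2) by
    ring.
  have h1 := dq1 j; have h2 := dqn j 2; have h3 := dqn j 3.
  by field; rewrite h1 h2 h3.
- by apply: nearW.
Qed.


(** The first columns of [R_1] and [T_0] are (alpha 1, alpha 2) and (beta 0, beta 1). Undoing the
    weights, the pair (a 0, a 1) is proportional to (alpha 1, mu alpha 2 / (b+1)) from the right and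
    to (-mu beta 1 / (b+n-2), beta 0) from the left; this is the determinant of these two vectors
    times (b+1)(b+n-2). *)
Definition resonance (alpha beta : nat -> C) : C :=
  (b + 1) * (b + n - 2) * alpha 1%N * beta 0%N + mu ^+ 2 * alpha 2%N * beta 1%N.

(** * Gluing the two decaying solutions, and uniqueness of each *)

Section one_sided_solutions.
Variables alpha beta : nat -> C.
Hypothesis alpha1 : alpha k @[k --> \oo] --> (1 : C).
Hypothesis alphaS : forall k,
  alpha k = matM n lam mu b k 0 0 * alpha k.+1 + matM n lam mu b k 0 1 * alpha k.+2.
Hypothesis beta1 : beta k @[k --> \oo] --> (1 : C).
Hypothesis betaS : forall k,
  beta k = matS n lam mu b k 0 0 * beta k.+1 + matS n lam mu b k 0 1 * beta k.+2.

Let M00 k : matM n lam mu b k 0 0 = 1 + lam / ((k%:R + b) * (k%:R + b + n - 1)).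
Proof. by rewrite mxE. Qed.
Let M01 k : matM n lam mu b k 0 1 = mu ^+ 2 / ((k%:R + b) * (k%:R + b + n - 1)).
Proof. by rewrite mxE. Qed.
Let S00 m : matS n lam mu b m 0 0 =
  1 + (lam - n + 2) / ((b - m%:R + 1) * (b - m%:R + n - 2)).
Proof. by rewrite mxE. Qed.
Let S01 m : matS n lam mu b m 0 1 =
  mu ^+ 2 * (b - m%:R + n - 1) / ((b - m%:R + 1) * (b - m%:R + n - 2) * (b - m%:R + n - 3)).
Proof. by rewrite mxE. Qed.

Let M01_neq0 k : matM n lam mu b k 0 1 != 0.
Proof. by rewrite M01 !mulf_neq0 ?invr_neq0 ?mulf_neq0 ?dp ?dpn. Qed.
Let S01_neq0 m : matS n lam mu b m 0 1 != 0.
Proof.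
have h1 := dq1 m; have h2 := dqn m 2; have h3 := dqn m 3; have h4 := dqn m 1.
by rewrite S01 !mulf_neq0 ?invr_neq0 ?mulf_neq0.
Qed.

(** Two consecutive zeros propagate to all larger indices because [y] never vanishes, against the
    limit 1. *)
Let nontrivial (u x y : nat -> C) : (forall k, u k = x k * u k.+1 + y k * u k.+2) ->
  (forall k, y k != 0) -> u k @[k --> \oo] --> (1 : C) ->
  forall k, u k = 0 -> u k.+1 = 0 -> False.
Proof.
move=> uS y0 u1 k h1 h2.
have z j : u (k + j)%N = 0 /\ u (k + j).+1 = 0.
  elim: j => [|j [e1 e2]]; first by rewrite addn0.
  rewrite addnS; split=> //; have := uS (k + j)%N; rewrite e1 e2 mulr0 add0r => /esym/eqP.
  by rewrite mulf_eq0 (negPf (y0 _)) /= => /eqP.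
have c0 : u (k + j)%N @[j --> \oo] --> (0 : C).
  have -> : (fun j => u (k + j)%N) = (fun=> 0) by apply/funext => j; case: (z j).
  exact: cvg_cst.
have c1 : u (k + j)%N @[j --> \oo] --> (1 : C) by exact: (cvg_comp _ _ (@cvg_addnl k) u1).
have e01 : 0 = 1 :> C := cvg_unique (@norm_hausdorff _ _) c0 c1.
by have := oner_neq0 C; rewrite -e01 eqxx.
Qed.

Let alpha12 : (alpha 1%N != 0) || (alpha 2%N != 0).
Proof.
rewrite -negb_and; apply/negP => /andP[/eqP a1 /eqP a2].
exact: (nontrivial alphaS M01_neq0 alpha1 a1 a2).
Qed.

Let beta01 : (beta 0%N != 0) || (beta 1%N != 0).
Proof.
rewrite -negb_and; apply/negP => /andP[/eqP a1 /eqP a2].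
exact: (nontrivial betaS S01_neq0 beta1 a1 a2).
Qed.

Let entire_pweight : entire_coef pweight.
Proof.
move=> r r0; apply: (ratio_decay r0 pweightS).
have h := cvgM (cvg_cst mu) (cvg_comp _ _ (@cvg_addnl 1) (@cvg_inv_shift R b)).
by rewrite mulr0 in h; exact: h.
Qed.

Let entire_qweight : entire_coef qweight.
Proof.
move=> r r0; apply: (ratio_decay r0 qweightS).
have h := cvgM (cvg_cst mu) (@cvg_inv_shift R (2 - b - n)); rewrite mulr0 in h.
have -> : (fun j => - mu / (b - j%:R + n - 2)) = (fun j => mu * (j%:R + (2 - b - n))^-1).
  apply/funext => j; have -> : b - j%:R + n - 2 = - (j%:R + (2 - b - n)) by ring.
  by rewrite invrN mulrNN.
exact: h.
Qed.

Let entire_bounded (p u : nat -> C) (l : C) (s : C) : entire_coef p -> u k @[k --> \oo] --> l ->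
  entire_coef (fun k => s * (u k * p k)).
Proof.
move=> ep ul; apply: entire_coefZ; have [B uB] := cvg_cabs_bounded ul.
apply: (entire_coefM (K := B) _ ep) => k; apply: le_trans (uB k) _.
have B0 : 0 <= B := le_trans (cabs_ge0 _) (uB 0%N).
by rewrite ler_peMr // exprn_ege1 // ler1n.
Qed.

Lemma resonance_recurrence : resonance alpha beta = 0 -> exists a : int -> C,
  [/\ laurent_coef a, recurrence a & (a 0 != 0) || (a 1 != 0)].
Proof.
rewrite /resonance => D0.
have h1 := b_neq0 1; rewrite /= addrC in h1.
have h2 := dqn 0 2; rewrite subr0 in h2.
(* [D0] makes the two candidates for (a 0, a 1) parallel, and [s], [t] are entries of the opposite
   candidate. Splitting on [beta 0] selects a component known to be nonzero, so that the common
   vector is nonzero as well. *)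
have [s [t [st0 st1 nz]]] : exists s t : C,
  [/\ s * alpha 1%N = t * (- mu / (b + n - 2) * beta 1%N),
      s * (mu / (b + 1) * alpha 2%N) = t * beta 0%N &
      (s * alpha 1%N != 0) || (s * (mu / (b + 1) * alpha 2%N) != 0)].
  have [bz|bnz] := eqVneq (beta 0%N) 0.
    have b1 : beta 1%N != 0 by move: beta01; rewrite bz eqxx.
    have a2 : alpha 2%N = 0.
      move/eqP: D0; rewrite bz mulr0 add0r !mulf_eq0 (negPf hmu) (negPf b1) /= orbF.
      by move/eqP.
    have a1 : alpha 1%N != 0 by move: alpha12; rewrite a2 eqxx orbF.
    exists (- mu / (b + n - 2) * beta 1%N), (alpha 1%N); split.
    - by rewrite mulrC.
    - by rewrite a2 bz !mulr0.
    - by apply/orP; left; rewrite !mulf_neq0 ?invr_neq0 ?oppr_eq0.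
  exists (beta 0%N), (mu / (b + 1) * alpha 2%N); split.
  - apply/eqP; rewrite -subr_eq0.
    have -> : beta 0%N * alpha 1%N - mu / (b + 1) * alpha 2%N * (- mu / (b + n - 2) * beta 1%N) =
      ((b + 1) * (b + n - 2) * alpha 1%N * beta 0%N + mu ^+ 2 * alpha 2%N * beta 1%N) /
      ((b + 1) * (b + n - 2)) by field; apply/andP.
    by rewrite D0 mul0r.
  - by rewrite mulrC.
  - by rewrite !(mulf_eq0 (beta 0%N)) (negPf bnz) /= !mulf_eq0 invr_eq0 (negPf hmu) (negPf h1).
pose a (k : int) : C := match k with
  | Posz j => s * (alpha j.+1 * pweight j) | Negz j => t * (beta j.+2 * qweight j.+2) end.
have a0 : a 0 = s * alpha 1%N by rewrite -[LHS]/(s * (alpha 1%N * pweight 0)) pweight0 mulr1.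
have a1 : a 1 = s * (mu / (b + 1) * alpha 2%N).
  rewrite -[LHS]/(s * (alpha 2%N * pweight 1)) pweightS pweight0 mulr1 addrC; ring.
(* By definition of [a] this holds from m = 2 on; the matching extends it to m = 0 and m = 1. The
   left formula thus covers all indices up to 1 and proves the recurrence for k <= 0, while the
   right one covers k >= 1. *)
have aneg (m : nat) : a (1 - Posz m) = t * (beta m * qweight m).
  case: m => [|[|m]].
  - by rewrite subr0 a1 st1 qweight0 mulr1.
  - by rewrite subrr a0 st0 qweightS qweight0 subr0; ring.
  - by have -> : 1 - Posz m.+2 = Negz m by rewrite NegzE; clear; lia.
exists a; split.
- split; rewrite /a.
  + exact: (entire_bounded s entire_pweight (cvg_comp _ _ (@cvg_addnl 1) alpha1)).
  + apply: (entire_bounded t (entire_coefS (entire_coefS entire_qweight)) (cvg_comp _ _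
    (@cvg_addnl 2) beta1)).
- move=> k.
  case: (leP k 0) => k0.
    have [m ->] : exists m : nat, k = - Posz m by move: k0; clear; exists `|k|%N; lia.
    have -> : - Posz m = 1 - Posz m.+1 by clear; lia.
    have -> : 1 - Posz m.+1 + 1 = 1 - Posz m by clear; lia.
    have -> : 1 - Posz m.+1 - 1 = 1 - Posz m.+2 by clear; lia.
    have -> : (1 - Posz m.+1)%:~R = - m%:R :> C by have -> : 1 - Posz m.+1 = - Posz m; [clear;
      lia|rewrite rmorphN].
    have g1 := dq1 m; have g2 := dqn m 2; have g3 := dqn m 3.
    rewrite !aneg (betaS m) S00 S01 !qweightS -[m.+1%:R]natr1.
    move: (beta m.+1) (beta m.+2) (qweight m) (m%:R : C) g1 g2 g3 => u v q x g1 g2 g3.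
    have g4 : b - (x + 1) + n - 2 != 0 by have -> : b - (x + 1) + n - 2 = b - x + n - 3 by ring.
    by field; rewrite g1 g2 g4.
  have [j ->] : exists j : nat, k = Posz j.+1 by move: k0; clear; exists `|k|.-1%N; lia.
  have -> : Posz j.+1 - 1 = Posz j by clear; lia.
  have -> : Posz j.+1 + 1 = Posz j.+2 by clear; lia.
  have g1 := dp j.+1; have g2 := dpn j.+1; have g3 := dp j.+2.
  rewrite /a (alphaS j.+1) M00 M01 !pweightS.
  have -> : (Posz j.+1)%:~R = j%:R + 1 :> C by rewrite natr1.
  rewrite -?[j.+2%:R]natr1 -?[j.+1%:R]natr1 in g1 g2 g3 *.
  move: (alpha j.+2) (alpha j.+3) (pweight j) (j%:R : C) g1 g2 g3 => u v p x g1 g2 g3.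
  by field; rewrite g1 g2 g3.
- by rewrite a0 a1.
Qed.

(* Both one-sided halves of [a] are recessive, so their Casoratians with [alpha] and [beta] vanish;
   this is a linear system for [a 0] and [a 1] with determinant [resonance / mu ^+ 2]. *)
Lemma recurrence_eq0 (a : int -> C) (r : C) (B : R) : r != 0 -> recurrence a ->
  (forall k, cabs (a k * r ^ k) <= B) -> resonance alpha beta != 0 -> forall k, a k = 0.
Proof.
move=> r0 rec aB D0.
have fwd (j : nat) : ((j.+1%:R + b) * (j.+1%:R + b + n - 1) + lam) * a j.+1 + mu * (j.+2%:R + b)
  * a j.+2
    - mu * (j.+1%:R + b + n - 1) * a j = 0.
  have := rec j.+1.
  have -> : Posz j.+1 - 1 = Posz j by clear; lia.
  have -> : Posz j.+1 + 1 = Posz j.+2 by clear; lia.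
  by move=> <-; rewrite -[(Posz j.+1)%:~R]/(j.+1%:R) -[j.+2%:R]natr1; ring.
have bwd (m : nat) : ((b - m%:R) * (b - m%:R + n - 1) + lam) * a (1 - Posz m.+1) +
    mu * (b - m%:R + 1) * a (1 - Posz m) - mu * (b - m%:R + n - 1) * a (1 - Posz m.+2) = 0.
  have := rec (1 - Posz m.+1).
  have -> : 1 - Posz m.+1 + 1 = 1 - Posz m by clear; lia.
  have -> : 1 - Posz m.+1 - 1 = 1 - Posz m.+2 by clear; lia.
  have -> : (1 - Posz m.+1)%:~R = - m%:R :> C.
    by have -> : 1 - Posz m.+1 = - Posz m; [clear; lia|rewrite rmorphN].
  by move=> <-; ring.
(* The sequence a_j / p_j is the bounded a_j r^j times g_j = 1 / (r^j p_j). The ratio of g grows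
   only linearly in j, whereas the entry of [M_(j+1)] playing [y] is O(1/j^2). *)
have e1 : alpha 1%N * (a 1 / pweight 1) = alpha 2%N * (a 0 / pweight 0).
  apply: (@casoratian_eq0 R (fun j => alpha j.+1) (fun j => a (Posz j) / pweight j)
    (fun j => matM n lam mu b j.+1 0 0) (fun j => matM n lam mu b j.+1 0 1) (fun j => a j * r ^+ j)
    (fun j => (r ^+ j * pweight j)^-1) (fun j => (j.+1%:R + b) / (mu * r)) B).
  - by move=> j; exact: alphaS.
  - move=> j; apply/eqP; rewrite -subr_eq0 M00 M01 !pweightS.
    have g1 := dp j.+1; have g2 := dpn j.+1; have g3 := dp j.+2; have g4 := pweight_neq0 j.
    have h := fwd j.
    set e := (X in X == 0).
    have -> : e = - (((j.+1%:R + b) * (j.+1%:R + b + n - 1) + lam) * a j.+1 + mu * (j.+2%:R + b)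
      * a j.+2
      - mu * (j.+1%:R + b + n - 1) * a j) / (mu * (j.+1%:R + b + n - 1) * pweight j).
      rewrite /e; move: (a j) (a j.+1) (a j.+2) (j.+1%:R : C) (j.+2%:R : C) (pweight j) hmu g1 g2
        g3 g4.
      move=> u v w x y p m0 g1 g2 g3 g4; field; by rewrite ?m0 ?g1 ?g2 ?g3 ?g4.
    by rewrite h oppr0 mul0r.
  - by move=> j; exact: M01_neq0.
  - exact: (cvg_comp _ _ (@cvg_addnl 1) alpha1).
  - by move=> j; rewrite invfM mulrA mulfK // expf_neq0.
  - by move=> j; exact: (aB (Posz j)).
  - move=> j; rewrite pweightS exprS !invfM !invrK; ring.
  - have -> : (fun j => (j.+1%:R + b) / (mu * r) * matM n lam mu b j.+1 0 1) =
        (fun j => (mu / r) * (1 + 0 * (j%:R + b)^-1) * (j%:R + (b + n))^-1).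
      apply/funext => j; have g1 := dp j.+1; have g2 := dpn j.+1.
      rewrite M01 mul0r addr0; rewrite -[j.+1%:R]natr1 in g1 g2 *.
      move: (j%:R : C) hmu r0 g1 g2 => x m0 r0 g1 g2.
      have g3 : x + (b + n) != 0 by have <- : x + 1 + b + n - 1 = x + (b + n) by ring.
      by field; rewrite ?g1 ?g2 ?g3 ?m0 ?r0.
    exact: cvg_inv_shift2.
  - have -> : (fun j => (j.+2%:R + b) / (mu * r) * matM n lam mu b j.+1 0 1) =
        (fun j => (mu / r) * (1 + 1 * (j%:R + (1 + b))^-1) * (j%:R + (b + n))^-1).
      apply/funext => j; have g1 := dp j.+1; have g2 := dpn j.+1.
      rewrite M01; rewrite -?[j.+2%:R]natr1 -?[j.+1%:R]natr1 in g1 g2 *.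
      move: (j%:R : C) hmu r0 g1 g2 => x m0 r0 g1 g2.
      have g3 : x + (b + n) != 0 by have <- : x + 1 + b + n - 1 = x + (b + n) by ring.
      have g4 : x + (1 + b) != 0 by rewrite addrA.
      by field; rewrite ?g1 ?g2 ?g3 ?g4 ?m0 ?r0.
    exact: cvg_inv_shift2.
(* The same argument towards -oo with a_(1-m) / q_m; the offset 1 - m in the exponent of r accounts
   for the division by r in [g]. *)
have e2 : beta 0%N * (a (1 - Posz 1) / qweight 1) = beta 1%N * (a (1 - Posz 0) / qweight 0).
  apply: (@casoratian_eq0 R beta (fun m => a (1 - Posz m) / qweight m)
    (fun m => matS n lam mu b m 0 0) (fun m => matS n lam mu b m 0 1) (fun m => a (1 - Posz m) *
      r ^ (1 - Posz m))
    (fun m => r ^+ m / r / qweight m) (fun m => - (b - m%:R + n - 2) * r / mu) B).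
  - by [].
  - move=> m; apply/eqP; rewrite -subr_eq0 S00 S01 !qweightS.
    have g1 := dq1 m; have g2 := dqn m 2; have g3 := dqn m 3; have g4 := qweight_neq0 m.
    have h := bwd m.
    set e := (X in X == 0).
    have -> : e = (((b - m%:R) * (b - m%:R + n - 1) + lam) * a (1 - Posz m.+1) +
      mu * (b - m%:R + 1) * a (1 - Posz m) - mu * (b - m%:R + n - 1) * a (1 - Posz m.+2)) /
      (mu * (b - m%:R + 1) * qweight m).
      rewrite /e -[m.+1%:R]natr1.
      move: (a (1 - Posz m)) (a (1 - Posz m.+1)) (a (1 - Posz m.+2)) (m%:R : C) (qweight m) hmu
        g1 g2 g3 g4.
      move=> u v w x q m0 g1 g2 g3 g4.
      have g5 : b - (x + 1) + n - 2 != 0 by have -> : b - (x + 1) + n - 2 = b - x + n - 3 by ring.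
      by field; rewrite ?m0 ?g1 ?g2 ?g3 ?g4 ?g5.
    by rewrite h mul0r.
  - by move=> j; exact: S01_neq0.
  - exact: beta1.
  - move=> m; have rm : r ^+ m != 0 by rewrite expf_neq0.
    rewrite expfzDr // expr1z -exprnN; have g4 := qweight_neq0 m.
    move: (r ^+ m) (qweight m) (a _) rm g4 => u q v rm g4.
    by field; rewrite ?rm ?g4 ?r0.
  - by move=> j; exact: aB.
  - move=> m; rewrite qweightS exprS; have g2 := dqn m 2; have g4 := qweight_neq0 m.
    move: (r ^+ m) (b - m%:R + n - 2) (qweight m) hmu r0 g2 g4 => u x q m0 r0 g2 g4.
    by field; rewrite ?m0 ?r0 ?g2 ?g4.
  - have -> : (fun m => - (b - m%:R + n - 2) * r / mu * matS n lam mu b m 0 1) =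
        (fun m => (r * mu) * (1 + - 2 * (m%:R + (3 - b - n))^-1) * (m%:R + (- b - 1))^-1).
      apply/funext => m; have g1 := dq1 m; have g2 := dqn m 2; have g3 := dqn m 3.
      rewrite S01; move: (m%:R : C) hmu r0 g1 g2 g3 => x m0 r0 g1 g2 g3.
      have -> : x + (3 - b - n) = - (b - x + n - 3) by ring.
      have -> : x + (- b - 1) = - (b - x + 1) by ring.
      by field; rewrite ?g1 ?g2 ?g3 ?m0.
    exact: cvg_inv_shift2.
  - have -> : (fun m => - (b - m.+1%:R + n - 2) * r / mu * matS n lam mu b m 0 1) =
        (fun m => (r * mu) * (1 + - 1 * (m%:R + (2 - b - n))^-1) * (m%:R + (- b - 1))^-1).
      apply/funext => m; have g1 := dq1 m; have g2 := dqn m 2; have g3 := dqn m 3.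
      rewrite S01 -[m.+1%:R]natr1; move: (m%:R : C) hmu r0 g1 g2 g3 => x m0 r0 g1 g2 g3.
      have -> : x + (2 - b - n) = - (b - x + n - 2) by ring.
      have -> : x + (- b - 1) = - (b - x + 1) by ring.
      by field; rewrite ?g1 ?g2 ?g3 ?m0.
    exact: cvg_inv_shift2.
rewrite subrr subr0 qweightS qweight0 subr0 in e2.
rewrite pweightS pweight0 in e1.
have h1 := b_neq0 1; rewrite /= addrC in h1.
have h2 := dqn 0 2; rewrite subr0 in h2.
have {}e1 : alpha 1%N * (b + 1) * a 1 = mu * alpha 2%N * a 0.
  apply: etrans (etrans (congr1 (fun x => mu * x) e1) _); last by rewrite divr1 mulrA.
  by field; rewrite hmu andbT; exact: (b_neq0 1).
have {}e2 : beta 0%N * (b + n - 2) * a 0 = - mu * beta 1%N * a 1.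
  apply: etrans (etrans (congr1 (fun x => - mu * x) e2) _); last by rewrite divr1 mulrA.
  by field; rewrite ?hmu ?h2.
have a0 : a 0 = 0.
  have : resonance alpha beta * a 0 = 0.
    have -> : resonance alpha beta * a 0 = (b + 1) * alpha 1%N * (beta 0%N * (b + n - 2) * a 0)
      + mu * beta 1%N * (mu * alpha 2%N * a 0) by rewrite /resonance; ring.
    by rewrite e2 -e1; ring.
  by move/eqP; rewrite mulf_eq0 (negPf D0) => /eqP.
have a1 : a 1 = 0.
  have : resonance alpha beta * a 1 = 0.
    have -> : resonance alpha beta * a 1 = (b + n - 2) * beta 0%N * (alpha 1%N * (b + 1) * a 1)
      - mu * alpha 2%N * (- mu * beta 1%N * a 1) by rewrite /resonance; ring.
    by rewrite e1 -e2; ring.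
  by move/eqP; rewrite mulf_eq0 (negPf D0) => /eqP.
(* From a 0 = a 1 = 0 the zeros spread both ways: going up one divides by a value of k + b, going
   down by a value of k + b + n - 1, both nonzero. *)
have posz (j : nat) : a (Posz j) = 0 /\ a (Posz j.+1) = 0.
  elim: j => [|j [u v]]; first by [].
  split=> //; have := fwd j; rewrite u v !mulr0 add0r subr0 => /eqP.
  by rewrite !mulf_eq0 (negPf hmu) (negPf (dp _)) /= => /eqP.
have negz (m : nat) : a (1 - Posz m) = 0 /\ a (1 - Posz m.+1) = 0.
  elim: m => [|m [u v]]; first by rewrite subr0 subrr.
  split=> //; have := bwd m; rewrite u v !mulr0 add0r add0r => /eqP.
  by rewrite oppr_eq0 !mulf_eq0 (negPf hmu) (negPf (dqn m 1)) /= => /eqP.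
case=> j; first by case: (posz j).
by have [_] := negz j.+1; have -> : 1 - Posz j.+2 = Negz j by rewrite NegzE; clear; lia.
Qed.

End one_sided_solutions.
End heun.

(** * Eigenfunctions *)

Section fourier_rules.
Variable R : realType.
Local Notation C := (Cplx R).
Implicit Types (phi psi : C -> C) (z : C) (k : int).
Variable z0 : C.
Hypothesis z00 : z0 != 0.

(** Integration by parts: [cint_theta] applied to phi * mode (-k), on which z d/dz produces the term
    -k phi * mode (-k) besides psi * mode (-k). *)
Lemma fcoef_theta phi psi k : (forall z, z != 0 -> is_derive z 1 phi (psi z / z)) ->
  continuous_star psi -> fcoef z0 psi k = k%:~R * fcoef z0 phi k.
Proof.
move=> dphi cpsi; have cphi : continuous_star phi := derive_star dphi.
have cm := @mode_star R z0 (- k).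
have c1 := mulr_star cpsi cm; have c2 := mulr_star cphi cm.
have c3 := mulr_star (@cst_star R (- k%:~R)) c2.
have d z : z != 0 -> is_derive z 1 (fun z => phi z * mode z0 (- k) z)
    ((psi z * mode z0 (- k) z + - k%:~R * (phi z * mode z0 (- k) z)) / z).
  move=> hz; have h := is_deriveM (dphi z hz) (is_derive_mode z0 (- k) hz).
  have -> : (psi z * mode z0 (- k) z + - k%:~R * (phi z * mode z0 (- k) z)) / z =
    phi z * ((- k)%:~R * mode z0 (- k) z / z) + mode z0 (- k) z * (psi z / z).
    by rewrite rmorphN; ring.
  exact: h.
have := cint_theta z00 d (addr_star c1 c3).
rewrite (cintD z00 c1 c3) (cintZ z00 _ c2) mulNr => /eqP.
by rewrite subr_eq0 => /eqP.
Qed.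

Lemma fcoef_mulz phi k : continuous_star phi ->
  fcoef z0 (fun z => z * phi z) k = z0 * fcoef z0 phi (k - 1).
Proof.
move=> cphi; rewrite /fcoef -(cintZ z00 _ (mulr_star cphi (@mode_star R z0 _))).
apply: (eq_cint z00) => z hz.
have -> : mode z0 (- (k - 1)) z = z / z0 * mode z0 (- k) z.
  by rewrite opprB (modeD z00 _ _ hz) [mode z0 1 z]expr1z.
by field.
Qed.

Lemma fcoef_divz phi k : continuous_star phi ->
  fcoef z0 (fun z => z^-1 * phi z) k = z0^-1 * fcoef z0 phi (k + 1).
Proof.
move=> cphi; rewrite /fcoef -(cintZ z00 _ (mulr_star cphi (@mode_star R z0 _))).
apply: (eq_cint z00) => z hz.
have -> : mode z0 (- k) z = z / z0 * mode z0 (- (k + 1)) z.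
  by rewrite -[z / z0]expr1z -/(mode z0 1 z) -(modeD z00 _ _ hz) opprD addrCA subrr addr0.
by field; apply/andP.
Qed.

End fourier_rules.

Section eigenfunction_coefficients.
Variable R : realType.
Local Notation C := (Cplx R).
Variables n lam mu b : C.

(** Dividing by a local branch of z^b leaves an equation for the single-valued [f] on all of the
    punctured plane. It is written as a first-order system for f and t1 = z f', the form to which
    [fcoef_theta] applies twice. *)
Lemma eigenfunction_theta_equation (f : C -> C) : monodromy_eigenfunction n lam mu b f ->
  exists t1 : C -> C, [/\ forall z : C, z != 0 -> is_derive z 1 f (t1 z / z) &
   forall z : C, z != 0 -> is_derive z 1 t1 ((- (2 * b - 1 + n) * t1 z + (- (b * (b - 1) + n * b
     + lam) * f z +
     (- mu * (z^-1 * (t1 z + b * f z)) + mu * (z * (t1 z + (b + n) * f z))))) / z)].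
Proof.
move=> [hf sol _]; pose f1 := derive1 f.
have df (z : C) : z != 0 -> is_derive z 1 f (f1 z).
  by move=> z0; rewrite /f1 derive1E; exact: derivableP (hf z z0).
have main (z : C) : z != 0 -> exists2 f2 : C, is_derive z 1 f1 f2 &
  z ^+ 2 * (b / z * (b / z * f z + f1 z) + (b * (- z^-1 / z * f z + z^-1 * f1 z) + f2))
  + (n * z + mu * (1 - z ^+ 2)) * (b / z * f z + f1 z) + (lam - mu * n * z) * f z = 0.
  move=> z0; have [U [L [hL Uz]]] := log_branch_at z0; have [oU _ expL] := hL.
  have U0 w : U w -> w != 0 by move=> /expL <-; exact: cexp_neq0.
  have [_ hE1 ode] := sol U L hL.
  set E := (fun z => cpow L b z * f z) in hE1 ode.
  have e1 w : U w -> derive1 E w = cpow L b w * (b / w * f w + f1 w).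
    move=> Uw; have h := is_deriveM (is_derive_cpow b hL Uw) (df w (U0 w Uw)).
    rewrite derive1E; case: h => _ e.
    have -> : cpow L b w * (b / w * f w + f1 w) = cpow L b w * f1 w + f w * (b / w * cpow L b w)
      by ring.
    exact: e.
  have nU : \forall w \near z, U w by exact: open_nbhs_nbhs.
  (* Differentiability of [derive1 f] is not part of the definition of an eigenfunction; it is
     recovered here from that of [derive1 E], by solving the product rule for f'. *)
  have e2 w : U w -> f1 w = cpow L (- b) w * derive1 E w + - b * (w^-1 * f w).
    move=> Uw; rewrite e1 // mulrA.
    have -> : cpow L (- b) w * cpow L b w = 1.
      by rewrite /cpow -cexpD mulNr addNr cexp0.
    ring.
  have [f2 df2] : exists f2, is_derive z 1 f1 f2.
    have dE1 : is_derive z 1 (derive1 E) ('D_1 (derive1 E) z) := derivableP (hE1 z Uz).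
    have h1 := is_deriveM (is_derive_cpow (- b) hL Uz) dE1.
    have h2 := is_deriveM (is_derive_inv z0) (df z z0).
    have h := is_deriveD h1 (is_deriveZ (- b) h2).
    eexists; apply: (near_eq_is_derive _ h).
    by near=> w; rewrite e2 //; near: w; exact: nU.
  exists f2 => //.
  have dE : is_derive z 1 (derive1 E)
     (b / z * cpow L b z * (b / z * f z + f1 z) + cpow L b z * (b * (- z^-1 / z * f z + z^-1 * f1
       z) + f2)).
    have h2 := is_deriveM (is_derive_inv z0) (df z z0).
    have h3 := is_deriveD (is_deriveZ b h2) df2.
    have h := is_deriveM (is_derive_cpow b hL Uz) h3.
    have -> : b / z * cpow L b z * (b / z * f z + f1 z) + cpow L b z * (b * (- z^-1 / z * f z +
      z^-1 * f1 z) + f2) =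
      cpow L b z * (b * (z^-1 * f1 z + f z * (- z^-1 / z)) + f2) +
      (b * (z^-1 * f z) + f1 z) * (b / z * cpow L b z) by ring.
    apply: (near_eq_is_derive _ h).
    near=> w; have Uw : U w by near: w; exact: nU.
    by rewrite e1 // -[b / w * f w]mulrA.
  have := ode z Uz; rewrite e1 // (derive1E (derive1 E)).
  have -> : 'D_1 (derive1 E) z = b / z * cpow L b z * (b / z * f z + f1 z) + cpow L b z * (b * (-
    z^-1 / z * f z + z^-1 * f1 z) + f2).
    by case: dE.
  move=> h; apply: (mulfI (cpow_neq0 L b z)); rewrite mulr0 -[RHS]h /E; ring.
exists (fun z => z * f1 z); split => z z0.
  by rewrite mulrAC mulfV // mul1r; exact: df.
have [f2 df2 h] := main z z0.
have -> : (- (2 * b - 1 + n) * (z * f1 z) + (- (b * (b - 1) + n * b + lam) * f z +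
     (- mu * (z^-1 * (z * f1 z + b * f z)) + mu * (z * (z * f1 z + (b + n) * f z))))) / z
    = z * f2 + f1 z * 1.
  rewrite -[LHS]addr0 -[X in _ + X](mul0r z^-1) -h; field; exact: z0.
exact: (is_deriveM (is_derive_id z 1) df2).
Unshelve. all: by end_near. Qed.

(** The circle passes through a point [z0] where [f] does not vanish, so [fcoef_eq0] excludes the
    zero sequence. The factor z0^(-k) converts coefficients of (z / z0)^k into coefficients of z^k,
    and with r = z0 the bound is that of the Fourier coefficients. *)
Lemma eigenfunction_recurrence (f : C -> C) : monodromy_eigenfunction n lam mu b f ->
  exists (a : int -> C) (r : C) (B : R), [/\ r != 0, recurrence n lam mu b a,
    forall k, cabs (a k * r ^ k) <= B & exists k, a k != 0].
Proof.
move=> hf; have [t1 [df dt1]] := eigenfunction_theta_equation hf.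
have [_ _ [U [L [z0 [hL Uz fz0]]]]] := hf.
have z00 : z0 != 0 by have [_ _ /(_ z0 Uz) <-] := hL; exact: cexp_neq0.
have cf : continuous_star f := derive_star df.
have ct1 : continuous_star t1 := derive_star dt1.
have cid : continuous_star (fun z : C => z) := derive_star (fun z _ => is_derive_id z 1).
have cinv : continuous_star (fun z : C => z^-1) := derive_star (fun z hz => is_derive_inv hz).
have cs (s : C) phi := mulr_star (@cst_star R s) (psi := phi).
have g1 := addr_star ct1 (cs b _ cf); have g2 := addr_star ct1 (cs (b + n) _ cf).
have k1 := cs (- (2 * b - 1 + n)) _ ct1; have k2 := cs (- (b * (b - 1) + n * b + lam)) _ cf.
have m3 := mulr_star cinv g1; have m4 := mulr_star cid g2.
have k3 := cs (- mu) _ m3; have k4 := cs mu _ m4.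
have [B fB] := fcoef_bounded z00 cf.
have t1k k := fcoef_theta z00 k df ct1.
have eqk k := fcoef_theta z00 k dt1 (addr_star k1 (addr_star k2 (addr_star k3 k4))).
exists (fun k => fcoef z0 f k * z0 ^ (- k)), z0, B; split=> //.
- move=> k; have := eqk k.
  rewrite (fcoefD z00 _ k1 (addr_star k2 (addr_star k3 k4))) (fcoefD z00 _ k2 (addr_star k3 k4)).
  rewrite (fcoefD z00 _ k3 k4) (fcoefZ z00 _ _ ct1) (fcoefZ z00 _ _ cf) (fcoefZ z00 _ _ m3)
    (fcoefZ z00 _ _ m4).
  rewrite (fcoef_mulz z00 _ g2) (fcoef_divz z00 _ g1) (fcoefD z00 _ ct1 (cs b _ cf)) (fcoefD z00
    _ ct1 (cs (b + n) _ cf)).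
  rewrite !(fcoefZ z00 _ _ cf) !t1k !rmorphB !rmorphD /= => h.
  have -> : z0 ^ (- (k + 1)) = z0 ^ (- k) / z0 by rewrite opprD expfzDr // exprN1.
  have -> : z0 ^ (- (k - 1)) = z0 ^ (- k) * z0 by rewrite opprB addrC expfzDr // expr1z.
  move/eqP: h; rewrite -subr_eq0 => /eqP h.
  by rewrite -[RHS](mulr0 (- z0 ^ (- k))) -h; ring.
- by move=> k; rewrite -mulrA -expfzDr // addNr mulr1.
- apply: contrapT => nk; have fk k : fcoef z0 f k = 0.
    apply: contrapT => /eqP h; apply: nk; exists k.
    by rewrite mulf_neq0 // expfz_neq0.
  have := fcoef_eq0 z00 df fk => f0.
  by move: fz0; rewrite f0 mulr0 eqxx.
Qed.

End eigenfunction_coefficients.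

Local Close Scope classical_set_scope.
Local Close Scope complex_scope.

(* Matrix indices start from 0: the entry written A_{ij} is [A (i-1) (j-1)]. *)
Theorem theorem4p3 (R : realType) (n lam mu b : Cplx R)
    (hmu : mu != 0)
    (hb : forall k : int, b != k%:~R)
    (hbn : forall k : int, b + n != k%:~R) :
  (exists f : Cplx R -> Cplx R, monodromy_eigenfunction n lam mu b f) <->
  (b + 1) * (b + n - 2) * matR n lam mu b 1 0 0 * matT n lam mu b 0 0 0
    + mu ^+ 2 * matR n lam mu b 1 1 0 * matT n lam mu b 0 1 0 = 0.
Proof.
have [alpha [al1 alS RE RE']] := @forward_solution R n lam mu b.
have [beta [be1 beS TE TE']] := @backward_solution R n lam mu b hb hbn.
rewrite RE RE' TE TE' -/(resonance n mu b alpha beta).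
split.
  move=> [f hf]; have [a [r [B [r0 rec aB [k ak]]]]] := eigenfunction_recurrence hf.
  apply/eqP/negPn/negP => D0; move/eqP: ak; apply.
  exact: (recurrence_eq0 hmu hb hbn al1 alS be1 beS r0 rec aB D0).
move=> D0; have [a [ha rec a01]] := resonance_recurrence hmu hb hbn al1 alS be1 beS D0.
have [z z0 az] : exists2 z, z != 0 & lsum a z != 0.
  apply: contrapT => nz.
  have l0 z : z != 0 -> lsum a z = 0.
    by move=> z0; apply: contrapT => /eqP h; apply: nz; exists z.
  (* [lsum_eq0] only sees the coefficient of index 0; [a 1] is reached by dividing the series by
     z. *)
  move: a01; rewrite (lsum_eq0 ha l0) eqxx /= => /eqP; apply.
  apply: (lsum_eq0 (laurent_coef_succ ha)) => z z0.
  by rewrite lsum_succ // l0 // mulr0.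
exists (lsum a); split.
- by move=> w w0; case: (is_derive_lsum ha w0).
- by move=> U L; exact: laurent_solution.
- have [U [L [hL Uz]]] := log_branch_at z0.
  by exists U, L, z; split => //; rewrite mulf_neq0 // cpow_neq0.
Qed.
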